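(* For any $p \geq 1/2$, there is a comb domain $\mathscr{M}_{x}$ for which $E(\tau_{\mathscr{M}_{x}}^p)=\infty$.
   Context: Comb domain: let $(x_{n})_{n\in\mathbb{Z}}$ be an increasing sequence of distinct real numbers without accumulation point in $\mathbb{R}$ and let $(b_{n})_{n\in\mathbb{Z}}$ be an associated sequence of positive numbers. The corresponding comb domain is $\mathscr{M}_{x}:=\mathbb{C}\setminus\bigcup_{n\in\mathbb{Z}}I_{n}$, where $I_{n}:=\{x_{n}\}\times([b_n,+\infty)\cup(-\infty,-b_n])$ (identifying $\mathbb{C}$ with $\mathbb{R}^2$). For a domain $\Omega\subset\mathbb{C}$, $\tau_\Omega$ denotes the first exit time from $\Omega$ of a standard planar Brownian motion $Z_t$ started at a point of $\Omega$. Finiteness or infiniteness of $E(\tau_\Omega^p)$ does not depend on the starting point in $\Omega$ (a known fact due to Burkholder), so one writes $E(\tau_\Omega^p)<\infty$ or $E(\tau_\Omega^p)=\infty$ without specifying it. *)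

(* Defs.v *)
(* The complex plane is identified with R * R. *)
From mathcomp Require Import all_boot all_order all_algebra.
From mathcomp Require Import all_classical all_reals all_analysis.

Set Implicit Arguments.
Unset Strict Implicit.
Unset Printing Implicit Defensive.

Import Order.TTheory GRing.Theory Num.Theory.
Import numFieldNormedType.Exports.

Local Open Scope classical_set_scope.
Local Open Scope ring_scope.

Definition comb_data (R : realType) (x b : int -> R) : Prop :=
  [/\ {homo x : m n / m < n},
      limit_point (range x) = set0 &
      forall n, 0 < b n].

Definition comb_slit (R : realType) (u c : R) : set (R * R) :=
  [set u] `*` (`[c, +oo[ `|` `]-oo, - c]).

Definition comb_domain (R : realType) (x b : int -> R) : set (R * R) :=
  ~` \bigcup_n comb_slit (x n) (b n).

(* The product rule for subfamilies follows by taking some A i to be setT. *)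
Definition mutually_independent (R : realType) (d d' : measure_display)
    (T : measurableType d) (T' : measurableType d') (P : probability T R)
    (n : nat) (X : 'I_n -> T -> T') : Prop :=
  forall A : 'I_n -> set T', (forall i, measurable (A i)) ->
    P (\bigcap_i (X i @^-1` A i)) = (\prod_(i < n) P (X i @^-1` A i))%E.

(* The law of an increment over [s, t] is normal on the plane with covariance
   (t - s) I_2; the second parameter of normal_prob is the standard deviation.
   The values of Z at negative times are irrelevant. *)
Record planar_brownian_motion (R : realType) (d : measure_display)
    (T : measurableType d) (P : probability T R)
    (z : R * R) (Z : R -> T -> R * R) : Prop := PlanarBrownianMotion {
  pbm_measurable : forall t, 0 <= t -> measurable_fun setT (Z t) ;
  pbm_start : forall w, Z 0 w = z ;
  pbm_continuous : forall w, {within `[0, +oo[, continuous (Z ^~ w)} ;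
  pbm_increment_law : forall s t, 0 <= s -> s < t ->
    forall A, measurable A ->
      pushforward P (fun w => Z t w - Z s w) A =
      (normal_prob 0 (Num.sqrt (t - s)) \x normal_prob 0 (Num.sqrt (t - s)))%E A ;
  pbm_increments_independent : forall (n : nat) (t : nat -> R),
    0 <= t 0%N -> (forall i, (i < n)%N -> t i < t i.+1) ->
    mutually_independent P (fun (i : 'I_n) w => Z (t i.+1) w - Z (t i) w)
}.

(* Equals +oo when the path never leaves D. *)
Definition exit_time (R : realType) (T : Type) (D : set (R * R))
    (Z : R -> T -> R * R) (w : T) : \bar R :=
  ereal_inf [set t%:E | t in [set t : R | 0 <= t /\ ~ D (Z t w)]].

(* E(tau_D ^ p) = +oo from every starting point in D, for every realization of
   Brownian motion: the expectation depends only on the starting point, as it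
   is determined by the law of the process. *)
Definition infinite_exit_moment (R : realType) (D : set (R * R)) (p : R) :
    Prop :=
  forall (d : measure_display) (T : measurableType d) (P : probability T R)
    (z : R * R) (Z : R -> T -> R * R),
    D z -> planar_brownian_motion P z Z ->
    (\int[P]_w (exit_time D Z w `^ p) = +oo)%E.

(* Main.v *)
(* Take x_n = n and very long gaps |y| < b_n far away.  Since tau^p >= tau^(1/2)
   for tau >= 1, only the exponent 1/2 matters, which is critical for a
   half-plane: the exit time t of {x > N} has P(t > s) of order s^(-1/2), hence
   E(t^(1/2)) = sum_k 2^k P(t > 4^k) diverges logarithmically.  With a
   probability C q_N, where C depends on the starting point and q_N only on N,
   the path comes down to the central part of a strip and then jumps beyond
   abscissa N + 1 while |y| <= 2, crossing the slits through their gaps.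
   From there it behaves as in the half-plane {x > N} up to time 4^K, if the
   slits beyond N are so high that y does not reach them by that time.  So
   E(tau^(1/2)) >= c C q_N K, and K = K_N can be chosen after q_N and before
   the heights of the slits beyond N, with q_N K_N >= N.

   Probabilities of path events are bounded below along dyadic grids, where the
   increments of both coordinates form a finite independent sequence and Levy's
   inequality replaces the reflection principle. *)
Require Import Defs.
From mathcomp Require Import all_boot all_order all_algebra.
From mathcomp Require Import all_classical all_reals all_analysis.
From mathcomp Require Import measurable_realfun ring lra zify.

Set Implicit Arguments.
Unset Strict Implicit.
Unset Printing Implicit Defensive.
Import Order.TTheory GRing.Theory Num.Theory.
Import numFieldNormedType.Exports.
Local Open Scope classical_set_scope.
Local Open Scope ring_scope.

(** * Gaussian estimates *)

Lemma normal_pdf_opp (R : realType) (s x : R) : s != 0 ->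
  normal_pdf 0 s (- x) = normal_pdf 0 s x.
Proof. by move=> s0; rewrite !normal_pdfE// /normal_fun !subr0 sqrrN. Qed.

Lemma normal_prob_opp (R : realType) (s : R) (A : set R) : s != 0 ->
  measurable A -> normal_prob 0 s [set x | A (- x)] = normal_prob 0 s A.
Proof.
move=> s0 mA; rewrite /normal_prob.
have mo : measurable_fun setT (-%R : R -> measurableTypeR R) by [].
have mf : measurable_fun setT ((fun x => (normal_pdf 0 s x)%:E) : R -> \bar R).
  by apply/measurable_EFinP; exact: measurable_normal_pdf.
transitivity (\int[pushforward lebesgue_measure (-%R : R -> measurableTypeR R)]_(x in A)
   (normal_pdf 0 s x)%:E)%E; last first.
  by apply: eq_measure_integral => B mB BA; exact: lebesgue_measureN.
rewrite ge0_integral_pushforward//=.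
- by apply: eq_integral => x _; rewrite normal_pdf_opp.
- exact: measurable_funS mf.
- by move=> x _; rewrite lee_fin; exact: normal_pdf_ge0.
Qed.

(** Beyond [a] the density is at most [s / x ^+ 2], whose integral over the ray is [s / a]. This
    crude tail suffices, since later barriers are fixed multiples of the standard deviation. *)
Lemma normal_prob_gt (R : realType) (s a : R) : 0 < s -> 0 < a ->
  (normal_prob 0 s `]a, +oo[ <= (s / a)%:E)%E.
Proof.
move=> s0 a0; have sn0 : s != 0 by rewrite gt_eqF.
have pdf_le x : a <= x -> normal_pdf 0 s x <= s * x ^- 2.
  move=> ax; have x0 := lt_le_trans a0 ax.
  have peak_le : normal_peak s <= (2 * s)^-1.
    rewrite /normal_peak lef_pV2 ?posrE ?sqrtr_gt0 ?mulr_gt0//.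
      rewrite -[leLHS]gtr0_norm ?mulr_gt0// -sqrtr_sqr ler_wsqrtr//.
      rewrite -mulr_natr exprMn; have := pi_ge2 R.
      have := exprn_gt0 2 s0; nra.
    by rewrite mulrn_wgt0// mulr_gt0 ?pi_gt0 ?exprn_gt0.
  (* The exponential is bounded by [u^-1] because [expR u >= 1 + u]; multiplying by the peak bound
     [(2 * s)^-1] gives exactly [s * x ^- 2]. *)
  set u := x ^+ 2 / (s ^+ 2 *+ 2).
  have u0 : 0 < u by rewrite divr_gt0 ?exprn_gt0// mulrn_wgt0// exprn_gt0.
  have eu : expR (- u) <= u^-1.
    rewrite expRN lef_pV2 ?posrE ?expR_gt0//.
    by rewrite (le_trans _ (expR_ge1Dx _))// lerDr.
  rewrite normal_pdfE// /normal_fun subr0 mulNr -/u.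
  apply: (@le_trans _ _ ((2 * s)^-1 * u^-1)).
    by rewrite ler_pM ?expR_ge0 ?normal_peak_ge0.
  rewrite /u; suff -> : (2 * s)^-1 * (x ^+ 2 / (s ^+ 2 *+ 2))^-1 = s * x ^- 2 by [].
  by rewrite -mulr_natr; field; rewrite sn0 gt_eqF.

have cf : {within `[a, +oo[, continuous (fun x : R => s * x ^- 2)}.
  apply: continuous_in_subspaceT => x; rewrite inE/= in_itv/= andbT => ax.
  have x0 := lt_le_trans a0 ax.
  apply: cvgM; first exact: cvg_cst.
  by apply: cvgV; [rewrite expf_neq0// gt_eqF|exact: exprn_continuous].
apply: (@le_trans _ _ (\int[lebesgue_measure]_(x in `[a, +oo[) (s * x ^- 2)%:E)%E).
  apply: (@le_trans _ _ (normal_prob 0 s `[a, +oo[)%E).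
    by apply: le_measure; rewrite ?inE//; apply: subset_itvr; rewrite bnd_simp.
  rewrite /normal_prob; apply: ge0_le_integral => //=.
  - by move=> x _; rewrite lee_fin normal_pdf_ge0.
  - by apply: measurable_funTS; apply/measurable_EFinP; exact: measurable_normal_pdf.
  - by apply/measurable_EFinP; apply: subspace_continuous_measurable_fun.
  - by move=> x; rewrite in_itv/= andbT lee_fin => /pdf_le.
rewrite (@ge0_continuous_FTC2y _ _ (fun x => - s * x^-1) _ 0)//.
- by rewrite -EFinB sub0r mulNr opprK.
- by move=> x ax; rewrite mulr_ge0 ?invr_ge0 ?exprn_ge0 ?(ltW s0)// (le_trans (ltW a0)).
- rewrite -(mulr0 (- s)); apply: cvgM; first exact: cvg_cst.
  by apply/gtr0_cvgV0; [exact: nbhs_pinfty_gt|exact: cvg_id].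
- move=> x ax; apply: derivableM => //; apply: derivableV => //.
  by rewrite gt_eqF// (lt_trans a0).
- apply: cvgM; first exact: cvg_cst.
  apply: cvgV; first by rewrite gt_eqF.
  exact: cvg_at_right_filter.
- move=> x; rewrite in_itv/= andbT => ax; have x0 : x != 0 by rewrite gt_eqF// (lt_trans a0).
  rewrite derive1E deriveM//; last exact: derivableV.
  rewrite deriveV// derive_cst derive_id scaler0 addr0.
  by rewrite /GRing.scale/= mulr1 mulrNN.
Qed.

Lemma normal_pdf_gt0 (R : realType) (s x : R) : 0 < s -> 0 < normal_pdf 0 s x.
Proof.
move=> s0; rewrite normal_pdfE ?gt_eqF//.
by rewrite mulr_gt0 ?expR_gt0// normal_peak_gt0 ?gt_eqF.
Qed.

Lemma measurable_EFin_normal_pdf (R : realType) (s : R) (A : set R) :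
  measurable A -> measurable_fun A ((fun x => (normal_pdf 0 s x)%:E) : R -> \bar R).
Proof.
move=> mA; apply: measurable_funTS; apply/measurable_EFinP.
exact: measurable_normal_pdf.
Qed.

(** The centred density decreases with the absolute value, so on the interval it is at least its
    value at [c]. *)
Lemma normal_prob_itv_ge (R : realType) (s a b c : R) : 0 < s -> a <= b ->
  (forall x, a <= x <= b -> `|x| <= c) ->
  ((normal_pdf 0 s c * (b - a))%:E <= normal_prob 0 s `[a, b])%E.
Proof.
move=> s0 ab xc; have sn0 : s != 0 by rewrite gt_eqF.
have -> : ((normal_pdf 0 s c * (b - a))%:E =
    \int[lebesgue_measure]_(x in `[a, b]) (normal_pdf 0 s c)%:E)%E.
  rewrite integral_cst//= lebesgue_measure_itv/= lte_fin EFinM.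
  by move: ab; rewrite le_eqVlt => /predU1P[->|->//]; rewrite ltxx subrr.
apply: ge0_le_integral => //=.
- by move=> x _; rewrite lee_fin normal_pdf_ge0.
- exact: measurable_EFin_normal_pdf.
- move=> x; rewrite in_itv/= => /xc xlec; rewrite lee_fin !normal_pdfE//.
  rewrite ler_wpM2l ?normal_peak_ge0// ler_expR /normal_fun !subr0.
  rewrite ler_pM2r ?invr_gt0 ?mulrn_wgt0 ?exprn_gt0// lerN2.
  by rewrite -(real_normK (num_real x)) lerXn2r ?nnegrE// (le_trans _ xlec).
Qed.

Lemma normal_prob_itv_gt0 (R : realType) (s a b : R) : 0 < s -> a < b ->
  (0 < normal_prob 0 s `[a, b])%E.
Proof.
move=> s0 ab; apply: lt_le_trans (normal_prob_itv_ge s0 (ltW ab) _).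
  by rewrite lte_fin mulr_gt0 ?normal_pdf_gt0 ?subr_gt0.
move=> x /andP[ax xb]; rewrite ler_norml.
instantiate (1 := `|a| + `|b|).
by have := ler_norm a; have := ler_norm b; have := ler_norm (- a); have := ler_norm (- b);
  rewrite !normrN; lra.
Qed.

(** The two closed half-lines cover the line and have equal mass by symmetry. *)
Lemma normal_prob_ge0 (R : realType) (s : R) : 0 < s ->
  ((2^-1)%:E <= normal_prob 0 s `[0%R, +oo[)%E.
Proof.
move=> s0; have sn0 : s != 0 by rewrite gt_eqF.
have N : normal_prob 0 s `]-oo, 0%R] = normal_prob 0 s `[0%R, +oo[.
  rewrite -normal_prob_opp//; congr normal_prob; apply/seteqP; split => x/=;
  by rewrite !in_itv/= ?andbT oppr_le0.
have : (1 <= normal_prob 0 s `[0%R, +oo[ + normal_prob 0 s `]-oo, 0%R])%E.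
  rewrite -(@probability_setT _ _ _ (normal_prob 0 s)).
  apply: le_trans (measureU2 _ _ _) => //.
  apply: le_measure; rewrite ?inE//; first exact: measurableU.
  move=> x _ /=; rewrite !in_itv/= andbT.
  by case: (leP 0 x) => [|/ltW]; [left|right].
rewrite N -(fineK (fin_num_measure (normal_prob 0 s) `[0%R, +oo[%classic _))//.
rewrite -EFinD !lee_fin; lra.
Qed.

(** The density is at most [s^-1], so [[0, s / 4]] takes at most a quarter from the half carried by
    the nonnegative ray. *)
Lemma normal_prob_quarter (R : realType) (s : R) : 0 < s ->
  ((4^-1)%:E <= normal_prob 0 s `[(s / 4)%R, +oo[)%E.
Proof.
move=> s0; have sn0 : s != 0 by rewrite gt_eqF.
have h : (normal_prob 0 s `[0%R, (s / 4)%R] <= (4^-1)%:E)%E.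
  apply: (@le_trans _ _ (\int[lebesgue_measure]_(x in `[0%R, (s / 4)%R]) (normal_peak s)%:E)%E).
    apply: ge0_le_integral => //=.
    - by move=> x _; rewrite lee_fin normal_pdf_ge0.
    - exact: measurable_EFin_normal_pdf.
    - by move=> x _; rewrite lee_fin normal_pdf_ub.
  rewrite integral_cst//= lebesgue_measure_itv/= lte_fin divr_gt0// oppr0 adde0.
  rewrite -EFinM lee_fin.
  suff : normal_peak s <= s^-1.
    by move=> /(ler_wpM2r (ltW s0)); rewrite mulVf//; lra.
  rewrite /normal_peak lef_pV2 ?posrE ?sqrtr_gt0//; last first.
    by rewrite mulrn_wgt0// mulr_gt0 ?pi_gt0 ?exprn_gt0.
  rewrite -[leLHS]gtr0_norm// -sqrtr_sqr ler_wsqrtr//.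
  rewrite -mulr_natr; have := pi_ge2 R.
  have := exprn_gt0 2 s0; nra.
have : (normal_prob 0 s `[0%R, +oo[ <=
    normal_prob 0 s `[0%R, (s / 4)%R] + normal_prob 0 s `[(s / 4)%R, +oo[)%E.
  apply: le_trans (measureU2 _ _ _) => //.
  apply: le_measure; rewrite ?inE//; first exact: measurableU.
  move=> x /=; rewrite !in_itv/= !andbT => ->/=.
  by case: (leP x (s / 4)) => [|/ltW]; [left|right].
move/(le_trans (normal_prob_ge0 s0)); move: h.
rewrite -(fineK (fin_num_measure (normal_prob 0 s) `[(s / 4)%R, +oo[%classic _))//.
rewrite -(fineK (fin_num_measure (normal_prob 0 s) `[0%R, (s / 4)%R]%classic _))//.
rewrite -EFinD !lee_fin; lra.
Qed.

(** The peak scales exactly like [s^-1], while the exponent at [2^-1] only moves closer to zero when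
    [s] exceeds 1. *)
Lemma normal_prob_half (R : realType) (s : R) : 1 <= s ->
  ((normal_pdf 0 1 2^-1 / s)%:E <= normal_prob 0 s `[(- 2^-1)%R, (2^-1)%R])%E.
Proof.
move=> s1; have s0 : 0 < s by lra.
apply: le_trans (@normal_prob_itv_ge _ _ _ _ 2^-1 s0 _ _); last 2 first.
- lra.
- by move=> x; rewrite ler_norml.
rewrite lee_fin !normal_pdfE ?gt_eqF// /normal_fun !subr0.
have -> : 2^-1 - - 2^-1 = 1 :> R by lra.
rewrite mulr1 mulrAC ler_pM ?expR_ge0 ?mulr_ge0 ?invr_ge0 ?(ltW s0) ?normal_peak_ge0//.
  rewrite /normal_peak -!mulrnAr sqrtrM ?sqr_ge0// (sqrtrM (pi *+ 2) (sqr_ge0 s)).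
  by rewrite !sqrtr_sqr normr1 mul1r (gtr0_norm s0) invfM mulrC.
rewrite ler_expR !mulNr lerN2 ler_wpM2l ?sqr_ge0//.
rewrite lef_pV2 ?posrE ?mulrn_wgt0 ?exprn_gt0//.
by rewrite lerMn2r/= lerXn2r ?nnegrE// ltW.
Qed.

Lemma normal_prob_ray_gt0 (R : realType) (s a : R) : 0 < s ->
  (0 < normal_prob 0 s `[a, +oo[)%E.
Proof.
move=> s0; apply: (@lt_le_trans _ _ (normal_prob 0 s `[a, a + 1]%classic)).
  by apply: normal_prob_itv_gt0; rewrite // ltrDl.
by apply: le_measure; rewrite ?inE//; apply: subset_itvl; rewrite bnd_simp.
Qed.

(** * Independence and Levy's inequality *)

(** For fixed [B], the finite measures sending [A] to [P (A & B)] (intersection) and to [P A * P B]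
    agree on the pi-system [G], hence on the sigma-algebra it generates. *)
Lemma indep_sigma_l (R : realType) d (T : measurableType d)
    (P : probability T R) (G : set (set T)) (B : set T) :
  G `<=` measurable -> setI_closed G -> G setT -> measurable B ->
  (forall A, G A -> P (A `&` B) = (P A * P B)%E) ->
  forall A, <<s G >> A -> P (A `&` B) = (P A * P B)%E.
Proof.
move=> Gm GI GT mB GB A sGA.
have PB0 : 0 <= fine (P B) by rewrite fine_ge0.
have Bfin : P B = (fine (P B))%:E by rewrite fineK// fin_num_measure.
have cT : \bigcup_k (fun _ : nat => [set: T]) k = setT by apply: bigcup_const; exists 0%N.
have /(_ (mrestr P mB) (mscale (NngNum PB0) P)) :=
  @g_sigma_algebra_measure_unique _ R T G Gm (fun=> setT) (fun=> GT)
  cT.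
move=> /(_ GI) /(_ _ _ A sGA).
have scaleE C : mscale (NngNum PB0) P C = (P B * P C)%E.
  by rewrite /mscale/= -Bfin.
move=> uniq; rewrite -[LHS]/(mrestr P mB A) uniq.
- by rewrite muleC; exact: scaleE.
- move=> C /GB PCB; transitivity (P B * P C)%E; last exact/esym/scaleE.
  by rewrite muleC -PCB.
- move=> _; rewrite -[X in (X < _)%E]/(P (setT `&` B)).
  by rewrite setTI Bfin ltry.
Qed.

(** The one-sided extension is applied twice, once for each factor. *)
Lemma indep_sigma (R : realType) d (T : measurableType d)
    (P : probability T R) (G H : set (set T)) :
  G `<=` measurable -> setI_closed G -> G setT ->
  H `<=` measurable -> setI_closed H -> H setT ->
  (forall A B, G A -> H B -> P (A `&` B) = (P A * P B)%E) ->
  forall A B, <<s G >> A -> <<s H >> B -> P (A `&` B) = (P A * P B)%E.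
Proof.
move=> Gm GI GT Hm HI HT GH A B sGA sHB.
have sGm : <<s G >> `<=` measurable.
  exact: smallest_sub (@sigma_algebra_measurable _ T) Gm.
rewrite setIC muleC; apply: (indep_sigma_l Hm HI HT (sGm _ sGA)) => // C HC.
rewrite setIC muleC; apply: (indep_sigma_l Gm GI GT (Hm _ HC)) => // D GD.
exact: GH.
Qed.

(** Finite intersections are taken, rather than single preimages, to obtain a pi-system generating
    the sigma-algebra of [xi k], ..., [xi l.-1]. *)
Definition cylinders (R : realType) (T : Type) (xi : nat -> T -> R)
    (k l : nat) : set (set T) :=
  [set A | exists2 B : nat -> set R, forall i, measurable (B i) &
    A = \bigcap_(i in [set i | (k <= i < l)%N]) xi i @^-1` B i].

Definition independent_upto (R : realType) d (T : measurableType d)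
    (P : probability T R) (xi : nat -> T -> R) (N : nat) : Prop :=
  (forall i, measurable_fun setT (xi i)) /\
  forall B : nat -> set R, (forall i, measurable (B i)) ->
    P (\bigcap_(i in [set i | (i < N)%N]) xi i @^-1` B i) =
    (\prod_(0 <= i < N) P (xi i @^-1` B i))%E.

Lemma cylinders_setI (R : realType) (T : Type) (xi : nat -> T -> R) k l :
  setI_closed (cylinders xi k l).
Proof.
move=> _ _ [B mB ->] [C mC ->]; exists (fun i => B i `&` C i).
  by move=> i; exact: measurableI.
rewrite -bigcapI; apply: eq_bigcapr => i _.
by rewrite preimage_setI.
Qed.

Lemma cylinders_setT (R : realType) (T : Type) (xi : nat -> T -> R) k l :
  cylinders xi k l setT.
Proof.
by exists (fun=> setT) => //; apply/seteqP; split.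
Qed.

Lemma cylinders1 (R : realType) (T : Type) (xi : nat -> T -> R) k l i B :
  (k <= i < l)%N -> measurable B -> cylinders xi k l (xi i @^-1` B).
Proof.
move=> kil mB; exists (fun j => if j == i then B else setT).
  by move=> j; case: ifP.
apply/seteqP; split => [w Bw j _/=|w/= /(_ i kil)]; last by rewrite eqxx.
by case: eqP => [->|].
Qed.

Lemma cylinders_sub (R : realType) (T : Type) (xi : nat -> T -> R) k l k' l' :
  (k' <= k)%N -> (l <= l')%N -> cylinders xi k l `<=` cylinders xi k' l'.
Proof.
move=> kk ll _ [B mB ->]; exists (fun i => if (k <= i < l)%N then B i else setT).
  by move=> i; case: ifP.
apply/seteqP; split => w/= Bw i /=.
  by move=> _; case: ifP => // /Bw.
by move=> kil; have := Bw i; rewrite /= kil; apply; lia.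
Qed.

Lemma cylinders_measurable (R : realType) d (T : measurableType d)
    (xi : nat -> T -> R) k l : (forall i, measurable_fun setT (xi i)) ->
  cylinders xi k l `<=` measurable.
Proof.
move=> mxi _ [B mB ->]; apply: bigcap_measurableType => i _.
by rewrite -[X in measurable X]setTI; exact: mxi.
Qed.

Lemma sigma_cylinders_measurable (R : realType) d (T : measurableType d)
    (xi : nat -> T -> R) k l : (forall i, measurable_fun setT (xi i)) ->
  <<s cylinders xi k l >> `<=` measurable.
Proof.
move=> mxi; apply: smallest_sub; first exact: sigma_algebra_measurable.
exact: cylinders_measurable.
Qed.

Lemma independent_upto_prod (R : realType) d (T : measurableType d)
    (P : probability T R) (xi : nat -> T -> R) N k l (B : nat -> set R) :
  independent_upto P xi N -> (k <= l)%N -> (l <= N)%N ->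
  (forall i, measurable (B i)) ->
  P (\bigcap_(i in [set i | (k <= i < l)%N]) xi i @^-1` B i) =
  (\prod_(k <= i < l) P (xi i @^-1` B i))%E.
Proof.
move=> [mxi ind] kl lN mB.
have := ind (fun i => if (k <= i < l)%N then B i else setT).
rewrite (_ : \bigcap_(i in _) _ = \bigcap_(i in [set i | (k <= i < l)%N]) xi i @^-1` B i).
  move=> ->; last by move=> i; case: ifP.
  rewrite (big_cat_nat (n := k))//=; last exact: leq_trans lN.
  rewrite (big_cat_nat (n := l) (m := k))//=.
  have out m n : (n <= k)%N || (l <= m)%N -> (\prod_(m <= i < n)
      P (xi i @^-1` (if (k <= i < l)%N then B i else setT)) = 1)%E.
    move=> mn; rewrite big_nat big1// => i /andP[mi ni].
    by rewrite ifF ?preimage_setT ?probability_setT//; lia.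
  rewrite (out 0%N k) ?leqnn// (out l N) ?leqnn ?orbT// mul1e mule1.
  by rewrite big_nat [RHS]big_nat; apply: eq_bigr => i ->.
apply/seteqP; split => w/= Bw i /=.
  by move=> kil; have := Bw i; rewrite /= kil; apply; lia.
by move=> _; case: ifP => // /Bw.
Qed.

(** Cylinders over adjacent ranges multiply by the product formula on the joined range; uniqueness
    of measures extends this to the generated sigma-algebras. *)
Lemma independent_upto_sigma (R : realType) d (T : measurableType d)
    (P : probability T R) (xi : nat -> T -> R) N k j l (A B : set T) :
  independent_upto P xi N -> (k <= j)%N -> (j <= l)%N -> (l <= N)%N ->
  <<s cylinders xi k j >> A -> <<s cylinders xi j l >> B ->
  P (A `&` B) = (P A * P B)%E.
Proof.
move=> ind kj jl lN; have mxi := ind.1.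
apply: indep_sigma; do ?[exact: cylinders_measurable|exact: cylinders_setI|exact: cylinders_setT].
move=> _ _ [C mC ->] [D mD ->].
rewrite (independent_upto_prod ind)//; last exact: leq_trans lN.
rewrite (independent_upto_prod ind)//.
pose E i := if (i < j)%N then C i else D i.
rewrite (_ : _ `&` _ = \bigcap_(i in [set i | (k <= i < l)%N]) xi i @^-1` E i).
  rewrite (independent_upto_prod ind)//; first last.
    by rewrite /E => i; case: ifP.
    exact: leq_trans jl.
  rewrite (big_cat_nat (n := j))//=; congr (_ * _)%E.
    by rewrite big_nat [RHS]big_nat; apply: eq_bigr => i; rewrite /E => /andP[_ ->].
  rewrite big_nat [RHS]big_nat; apply: eq_bigr => i; rewrite /E => /andP[ji _].
  by rewrite ltnNge ji.
apply/seteqP; split => w/=.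
  by move=> [Cw Dw] i/= kil; rewrite /E; case: ltnP => ij;[apply: Cw|apply: Dw] => /=; lia.
move=> Ew; split => i/= kil; have := Ew i; rewrite /E/=.
  by case/andP: (kil) => ki ->; apply; lia.
by case/andP: (kil) => ji il; rewrite ifF; [apply; lia|lia].
Qed.

(** * Partial sums and their maxima *)

Definition psum (R : realType) (T : Type) (xi : nat -> T -> R) (k l : nat)
    (w : T) : R := \sum_(k <= i < l) xi i w.

Lemma psum_cat (R : realType) (T : Type) (xi : nat -> T -> R) k j l w :
  (k <= j)%N -> (j <= l)%N -> psum xi k l w = psum xi k j w + psum xi j l w.
Proof. by move=> kj jl; rewrite /psum (big_cat_nat (n := j)). Qed.

Lemma psum_sigma_measurable (R : realType) d (T : measurableType d)
    (xi : nat -> T -> R) k l a b :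
  (k <= a)%N -> (b <= l)%N ->
  @measurable_fun _ _ (g_sigma_algebraType (cylinders xi k l)) R setT
    (psum xi a b).
Proof.
move=> ka; elim: b => [|b IH] bl.
  rewrite (_ : psum _ _ _ = cst 0); first exact: measurable_cst.
  by apply/funext => w; rewrite /psum big_geq.
have [ab|ab] := leqP a b; last first.
  rewrite (_ : psum _ _ _ = cst 0); first exact: measurable_cst.
  by apply/funext => w; rewrite /psum big_geq.
rewrite (_ : psum _ _ _ = fun w => psum xi a b w + xi b w); last first.
  by apply/funext => w; rewrite /psum big_nat_recr.
apply: measurable_funD; first by apply: IH; lia.
move=> _ B mB; rewrite setTI; apply: sub_gen_smallest.
by apply: cylinders1 => //; lia.
Qed.

Lemma psum_sigma_preimage (R : realType) d (T : measurableType d)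
    (xi : nat -> T -> R) k l a b (D : set R) :
  (k <= a)%N -> (b <= l)%N -> measurable D ->
  <<s cylinders xi k l >> [set w | D (psum xi a b w)].
Proof.
move=> ka bl mD; rewrite -[X in _ X]setTI.
exact: (psum_sigma_measurable (xi := xi) ka bl) D mD.
Qed.

(** The factor [e] will be 1 or -1, to treat upper and lower barriers together; the level [b] is
    extended because [+oo] encodes an absent barrier. *)
Lemma measurable_scale_gt (R : realType) (e : R) (b : \bar R) :
  measurable [set x : R | (b < (e * x)%:E)%E].
Proof.
have mf : measurable_fun setT ((fun x : R => (e * x)%:E) : R -> \bar R).
  by apply/measurable_EFinP; exact: measurable_funM.
rewrite (_ : mkset _ = setT `&` (fun x : R => (e * x)%:E) @^-1` `]b, +oo%E]%classic).
  by apply: mf => //; exact: emeasurable_itv.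
by apply/seteqP; split=> x /=; rewrite in_itv/= leey andbT => // -[].
Qed.

Lemma measurable_scale_ge0 (R : realType) (e : R) :
  measurable [set x : R | 0 <= e * x].
Proof.
have mf : measurable_fun setT (fun x : R => e * x) by exact: measurable_funM.
rewrite (_ : mkset _ = setT `&` (fun x : R => e * x) @^-1` `[0, +oo[%classic).
  exact: mf.
by apply/seteqP; split=> x /=; rewrite in_itv/= andbT => // -[].
Qed.

(** At the first passage above [b], the remaining sum is independent of the past and has the
    favourable sign with probability at least one half; then the final sum is above [b] too. *)
Lemma levy_inequality (R : realType) d (T : measurableType d)
    (P : probability T R) (xi : nat -> T -> R) N k l (e : R) (b : \bar R) :
  independent_upto P xi N -> (k <= l)%N -> (l <= N)%N ->
  (forall j, (k <= j <= l)%N ->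
    ((2^-1)%:E <= P [set w | (0 <= e * psum xi j l w)%R])%E) ->
  (P [set w | exists2 j, (k <= j <= l)%N & (b < (e * psum xi k j w)%:E)%E] <=
   2%:E * P [set w | (b < (e * psum xi k l w)%:E)%E])%E.
Proof.
move=> ind kl lN half; have mxi := ind.1.
pose f j w := (e * psum xi k (k + j) w)%:E.
(* [F j] is a first passage at offset [j] from [k], and [C j] says that what follows does not undo
   it. *)
pose F j := [set w | (b < f j w)%E] `&`
  \bigcap_(i in [set i | (i < j)%N]) ~` [set w | (b < f i w)%E].
pose C j := [set w | 0 <= e * psum xi (k + j) l w].
have mf i j m : (k + i <= m)%N ->
    <<s cylinders xi k m >> [set w | (b < f i w)%E].
  move=> im.
  exact: psum_sigma_preimage (measurable_scale_gt e b).
have sF j : <<s cylinders xi k (k + j) >> (F j).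
  pose GT := g_sigma_algebraType (cylinders xi k (k + j)).
  apply: (@measurableI _ GT); first exact: mf.
  apply: (@bigcap_measurableType _ GT) => i /= ij; apply: (@measurableC _ GT).
  by apply: mf => //; lia.
have sC j : (j <= l - k)%N -> <<s cylinders xi (k + j) l >> (C j).
  by move=> jl; exact: psum_sigma_preimage (measurable_scale_ge0 e).
have mF j : measurable (F j) by exact: (sigma_cylinders_measurable mxi (sF j)).
have mC j : (j <= l - k)%N -> measurable (C j).
  by move=> /sC; exact: sigma_cylinders_measurable.
have tF : trivIset setT F.
  apply/trivIsetP => i j _ _ ij; apply/seteqP; split => // w [[/= fi Fi] [fj Fj]].
  by move: ij; rewrite neq_ltn => /orP[ij|ji]; [exact: (Fj i)|exact: (Fi j)].
have FC j : (j <= l - k)%N -> (P (F j) <= 2%:E * P (F j `&` C j))%E.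
  move=> jl; rewrite (independent_upto_sigma ind _ _ lN (sF j) (sC j jl)); [|lia|lia].
  have kjl : (k <= k + j <= l)%N by lia.
  have := half _ kjl; rewrite -/(C j).
  rewrite -(fineK (fin_num_measure P _ (mF j))) -(fineK (fin_num_measure P _ (mC j jl))).
  rewrite -!EFinM !lee_fin; have : 0 <= fine (P (F j)) by rewrite fine_ge0.
  nra.
apply: (@le_trans _ _ (P (\big[setU/set0]_(j < (l - k).+1) F j))).
  apply: le_measure; rewrite ?inE.
  - rewrite (_ : mkset _ = \bigcup_(j in [set j | (k <= j <= l)%N])
        [set w | (b < (e * psum xi k j w)%:E)%E]).
      apply: bigcup_measurable => j /= kj.
      exact: (sigma_cylinders_measurable mxi
        (psum_sigma_preimage (leqnn k) (leqnn j) (measurable_scale_gt e b))).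
    by apply/seteqP; split => w/= [j]; exists j.
  - exact: bigsetU_measurable.
  - move=> w/= [j kjl bj]; rewrite -bigcup_mkord.
    have ex : exists i, (b < f i w)%E.
      by exists (j - k)%N; rewrite /f subnKC//; lia.
    have [i bi imin] := ex_minnP ex.
    have ij : (i <= j - k)%N by apply: imin; rewrite /f subnKC//; lia.
    exists i => /=; first lia.
    split => // m/= mi; apply/negP; apply: contraL mi => /imin.
    by rewrite -leqNgt.
apply: (@le_trans _ _ (\sum_(j < (l - k).+1) P (F j))%E).
  exact: Boole_inequality.
apply: (@le_trans _ _ (\sum_(j < (l - k).+1) 2%:E * P (F j `&` C j))%E).
  by apply: lee_sum => j _; apply: FC; rewrite -ltnS.
rewrite -ge0_sume_distrr//; apply: lee_wpmul2l => //.
rewrite -(@measure_semi_additive_ord_I _ _ _ P (fun j => F j `&` C j)).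
- apply: le_measure; rewrite ?inE.
  - apply: bigsetU_measurable => j _; apply: measurableI => //.
    by apply: mC; rewrite -ltnS.
  - exact: (sigma_cylinders_measurable mxi
      (psum_sigma_preimage (leqnn k) (leqnn l) (measurable_scale_gt e b))).
  - rewrite -(bigcup_mkord _ (fun j => F j `&` C j)) => w [j/= jl [[/= fj _] Cj]].
    rewrite (psum_cat _ _ (j := k + j)%N) ?mulrDr//; [|lia|lia].
    by rewrite (lt_le_trans fj)// /f lee_fin lerDl.
- by move=> j jl; apply: measurableI => //; apply: mC; rewrite -ltnS.
- apply/trivIsetP => i j _ _ ij; rewrite setIACA.
  by move/trivIsetP : tF => /(_ _ _ I I ij) ->; rewrite set0I.
- apply: bigsetU_measurable => j _; apply: measurableI => //.
  by apply: mC; rewrite -ltnS.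
Qed.

(** The interval from [-a] to [b]; writing both sides as upper bounds lets [+oo] remove either
    one. *)
Definition band (R : realType) (a b : \bar R) : set R :=
  [set x | (((- x)%:E <= a) /\ (x%:E <= b))%E].

Definition block (R : realType) (T : Type) (xi : nat -> T -> R) (k l : nat)
    (a b : \bar R) (K : set R) : set T :=
  [set w | (forall j, (k <= j <= l)%N -> band a b (psum xi k j w)) /\
    K (psum xi k l w)].

Lemma measurable_band (R : realType) (a b : \bar R) : measurable (band a b).
Proof.
rewrite (_ : band a b = ~` [set x | (a < (-1 * x)%:E)%E] `&`
    ~` [set x | (b < (1 * x)%:E)%E]).
  by apply: measurableI; apply: measurableC; exact: measurable_scale_gt.
apply/seteqP; split => x; rewrite /band/= mulN1r mul1r.
  by move=> [xa xb]; split; apply/negP; rewrite -leNgt.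
by move=> [/negP + /negP]; rewrite -!leNgt.
Qed.

Lemma block_sigma (R : realType) d (T : measurableType d)
    (xi : nat -> T -> R) k l a b K : measurable K ->
  <<s cylinders xi k l >> (block xi k l a b K).
Proof.
move=> mK; pose GT := g_sigma_algebraType (cylinders xi k l).
rewrite (_ : block _ _ _ _ _ _ =
  \bigcap_(j in [set j | (k <= j <= l)%N]) [set w | band a b (psum xi k j w)]
    `&` [set w | K (psum xi k l w)]); last by apply/seteqP; split.
apply: (@measurableI _ GT); last exact: psum_sigma_preimage.
apply: (@bigcap_measurableType _ GT) => j /= kjl.
by apply: psum_sigma_preimage => //; [lia|exact: measurable_band].
Qed.

(** A path ending in [K] either realizes the block or crosses a barrier, and Levy's inequality
    bounds each crossing by twice a tail of the final sum. *)
Lemma block_ge (R : realType) d (T : measurableType d)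
    (P : probability T R) (xi : nat -> T -> R) N k l (a b : \bar R) (K : set R) :
  independent_upto P xi N -> (k <= l)%N -> (l <= N)%N -> measurable K ->
  (forall e j, (e = 1 \/ e = -1) -> (k <= j <= l)%N ->
    ((2^-1)%:E <= P [set w | (0 <= e * psum xi j l w)%R])%E) ->
  (P [set w | K (psum xi k l w)] <= P (block xi k l a b K) +
   2%:E * P [set w | b < (1 * psum xi k l w)%:E] +
   2%:E * P [set w | a < (-1 * psum xi k l w)%:E])%E.
Proof.
move=> ind kl lN mK half; have mxi := ind.1.
have mexit e c : measurable
    [set w | exists2 j, (k <= j <= l)%N & (c < (e * psum xi k j w)%:E)%E].
  rewrite (_ : mkset _ = \bigcup_(j in [set j | (k <= j <= l)%N])
      [set w | (c < (e * psum xi k j w)%:E)%E]).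
    apply: bigcup_measurable => j /= kj.
    exact: (sigma_cylinders_measurable mxi
      (psum_sigma_preimage (leqnn k) (leqnn j) (measurable_scale_gt e c))).
  by apply/seteqP; split => w/= [j]; exists j.
have mblock := sigma_cylinders_measurable mxi (@block_sigma _ _ T xi k l a b K mK).
apply: le_trans (leeD (leeD (lexx _)
  (@levy_inequality _ _ _ P xi N k l 1 b ind kl lN (fun j => half 1 j (or_introl erefl))))
  (@levy_inequality _ _ _ P xi N k l (-1) a ind kl lN (fun j => half (-1) j (or_intror erefl)))).
apply: le_trans (leeD (measureU2 P _ _) (lexx _)) => //.
apply: le_trans (measureU2 P _ _) => //; last exact: measurableU.
apply: le_measure; rewrite ?inE.
- exact: (sigma_cylinders_measurable mxi
    (psum_sigma_preimage (leqnn k) (leqnn l) mK)).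
- by apply: measurableU => //; exact: measurableU.
- move=> w/= Kw.
  have [[j kj bj]|nb] := pselect (exists2 j, (k <= j <= l)%N &
      (b < (1 * psum xi k j w)%:E)%E); first by left; right; exists j.
  have [[j kj aj]|na] := pselect (exists2 j, (k <= j <= l)%N &
      (a < (-1 * psum xi k j w)%:E)%E); first by right; exists j.
  left; left; split => // j kjl; split.
    by rewrite leNgt; apply/negP => aj; apply: na; exists j => //; rewrite mulN1r.
  by rewrite leNgt; apply/negP => bj; apply: nb; exists j => //; rewrite mul1r.
Qed.

(** Induction splits off the last block. Measurability with respect to the past is carried along,
    since independence from the next block rests on it. *)
Lemma independent_upto_blocks (R : realType) d (T : measurableType d)
    (P : probability T R) (xi : nat -> T -> R) N L r (E : nat -> set T) :
  independent_upto P xi N -> (r * L <= N)%N ->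
  (forall q, (q < r)%N -> <<s cylinders xi (q * L) (q.+1 * L) >> (E q)) ->
  <<s cylinders xi 0 (r * L) >> (\bigcap_(q in [set q | (q < r)%N]) E q) /\
  P (\bigcap_(q in [set q | (q < r)%N]) E q) = (\prod_(0 <= q < r) P (E q))%E.
Proof.
move=> ind; elim: r => [|r IH] rN sE.
  rewrite (_ : \bigcap_(q in _) _ = setT); last by apply/seteqP; split.
  rewrite big_geq// probability_setT; split=> //.
  by apply: sub_gen_smallest; exact: cylinders_setT.
have [sI PI] := IH (leq_trans (leq_mul (leqnSn r) (leqnn L)) rN)
  (fun q qr => sE q (ltnW qr)).
have -> : \bigcap_(q in [set q | (q < r.+1)%N]) E q =
    \bigcap_(q in [set q | (q < r)%N]) E q `&` E r.
  apply/seteqP; split => [w Ew|w [Ew Er] q /=].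
    by split => [q/= qr|]; apply: Ew => /=; lia.
  by rewrite ltnS leq_eqVlt => /predU1P[->//|]; exact: Ew.
have sEr := sE r (leqnn _); split; last first.
  by rewrite (independent_upto_sigma ind _ _ rN sI sEr) ?leq_mul// PI big_nat_recr.
pose GT := g_sigma_algebraType (cylinders xi 0 (r.+1 * L)).
apply: (@measurableI _ GT).
  by apply: sub_sigma_algebra2 sI; apply: cylinders_sub; rewrite // leq_mul.
by apply: sub_sigma_algebra2 sEr; apply: cylinders_sub.
Qed.

(** * Phases of a planar Brownian path *)

(* With P(sup X > b) <= 2 P(X_end > b), this says that c bounds from below the
   probability that a real Brownian motion of duration s^2 stays in [-a, b] and
   ends in K. *)
Definition phase (R : realType) (s : R) (a b : \bar R) (K : set R) (c : R) : Prop :=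
  measurable K /\ (c%:E + 2%:E * normal_prob 0 s [set x | b < x%:E] +
    2%:E * normal_prob 0 s [set x | a < x%:E] <= normal_prob 0 s K)%E.

Definition increment_law (R : realType) d (T : measurableType d)
    (P : probability T R) (X : R -> T -> R) : Prop :=
  forall s t, 0 <= s -> s < t -> forall A, measurable A ->
    P [set w | A (X t w - X s w)] = normal_prob 0 (Num.sqrt (t - s)) A.

Lemma pbm_increment_rect (R : realType) d (T : measurableType d)
    (P : probability T R) z Z (s t : R) (A B : set R) :
  planar_brownian_motion P z Z -> 0 <= s -> s < t ->
  measurable A -> measurable B ->
  P ((fun w => Z t w - Z s w) @^-1` (A `*` B)) =
  (normal_prob 0 (Num.sqrt (t - s)) A * normal_prob 0 (Num.sqrt (t - s)) B)%E.
Proof.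
move=> bm s0 st mA mB.
have := pbm_increment_law bm s0 st (measurableX mA mB).
by rewrite product_measure1E.
Qed.

Lemma pbm_law1 (R : realType) d (T : measurableType d)
    (P : probability T R) z Z : planar_brownian_motion P z Z ->
  increment_law P (fun t w => (Z t w).1).
Proof.
move=> bm s t s0 st A mA.
have := pbm_increment_rect bm s0 st mA measurableT.
rewrite probability_setT mule1 => <-; congr (P _).
by apply/seteqP; split => w //= [].
Qed.

Lemma pbm_law2 (R : realType) d (T : measurableType d)
    (P : probability T R) z Z : planar_brownian_motion P z Z ->
  increment_law P (fun t w => (Z t w).2).
Proof.
move=> bm s t s0 st A mA.
have := pbm_increment_rect bm s0 st measurableT mA.
rewrite probability_setT mul1e => <-; congr (P _).
by apply/seteqP; split => w //= [].
Qed.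

(** The inequality in [phase] is [block_ge] with Gaussian tails. Times need to increase only from
    index [k] on: for the second coordinate they are [t (i - M)], constant below [M] by truncated
    subtraction. *)
Lemma phase_block (R : realType) d (T : measurableType d)
    (P : probability T R) (xi : nat -> T -> R) N k l a b K c
    (X : R -> T -> R) (t : nat -> R) :
  independent_upto P xi N -> (k < l)%N -> (l <= N)%N ->
  (forall i, 0 <= t i) -> (forall i j, (k <= i < j)%N -> t i < t j) ->
  (forall i j w, (k <= i <= j)%N -> (j <= l)%N ->
    psum xi i j w = X (t j) w - X (t i) w) ->
  increment_law P X -> phase (Num.sqrt (t l - t k)) a b K c ->
  (c%:E <= P (block xi k l a b K))%E.
Proof.
move=> ind kl lN t0 tmono psumE law [mK hK].
have tkl : t k < t l by apply: tmono; rewrite leqnn.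
set s := Num.sqrt _ in hK.
have s0 : 0 < s by rewrite sqrtr_gt0 subr_gt0.
have lawkl A : measurable A -> P [set w | A (psum xi k l w)] = normal_prob 0 s A.
  move=> mA; rewrite -(law _ _ (t0 k) tkl A mA); congr (P _).
  by apply/seteqP; split => w /=; rewrite psumE ?leqnn// ltnW.
have half e j : (e = 1 \/ e = -1) -> (k <= j <= l)%N ->
    ((2^-1)%:E <= P [set w | (0 <= e * psum xi j l w)%R])%E.
  (* For [j = l] the remaining sum is empty, so the event is sure; otherwise it is half of a
     symmetric law. *)
  move=> e1 /andP[kj]; rewrite leq_eqVlt => /predU1P[jl|jl].
    rewrite (_ : mkset _ = setT) ?probability_setT ?lee_fin ?invf_le1 ?ler1n//.
    apply/seteqP; split => // w _ /=.
    by rewrite jl psumE ?leqnn ?(ltnW kl)// subrr mulr0.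
  have tjl : t j < t l by apply: tmono; rewrite kj.
  have sj0 : 0 < Num.sqrt (t l - t j) by rewrite sqrtr_gt0 subr_gt0.
  have := law _ _ (t0 j) tjl _ (measurable_scale_ge0 e).
  rewrite (_ : mkset _ = [set w | (0 <= e * psum xi j l w)%R]); last first.
    by apply/seteqP; split => w /=; rewrite psumE ?kj// ltnW.
  move=> ->; apply: le_trans (normal_prob_ge0 sj0) _.
  case: e1 => ->.
    apply: le_measure; rewrite ?inE//; first exact: measurable_scale_ge0.
    by move=> x /=; rewrite in_itv/= andbT mul1r.
  have mray : measurable (`[0%R, +oo[%classic : set R) by exact: measurable_itv.
  rewrite -(normal_prob_opp (lt0r_neq0 sj0) mray).
  apply: le_measure; rewrite ?inE//; last first.
  - by move=> x /=; rewrite in_itv/= andbT mulN1r.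
  - exact: measurable_scale_ge0.
  - rewrite (_ : mkset _ = [set x | 0 <= -1 * x]); first exact: measurable_scale_ge0.
    by apply/seteqP; split => x /=; rewrite in_itv/= andbT mulN1r.
have := @block_ge _ _ _ P xi N k l a b K ind (ltnW kl) lN mK half.
rewrite (lawkl _ mK) (lawkl _ (measurable_scale_gt 1 b)) (lawkl _ (measurable_scale_gt (-1) a)).
rewrite (_ : [set x | b < (1 * x)%:E]%E = [set x | b < x%:E]%E); last first.
  by apply/seteqP; split => x /=; rewrite mul1r.
have -> : normal_prob 0 s [set x | (a < (-1 * x)%:E)%E] = normal_prob 0 s [set x | (a < x%:E)%E].
  have ma : measurable [set x : R | (a < x%:E)%E].
    rewrite (_ : mkset _ = [set x | (a < (1 * x)%:E)%E]).
      exact: measurable_scale_gt.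
    by apply/seteqP; split => x /=; rewrite mul1r.
  rewrite -(normal_prob_opp _ ma) ?gt_eqF//; congr normal_prob.
  by apply/seteqP; split => x /=; rewrite mulN1r.
move=> /(le_trans hK).
have mexit e : measurable [set x : R | (e < x%:E)%E].
  rewrite (_ : mkset _ = [set x | (e < (1 * x)%:E)%E]).
    exact: measurable_scale_gt.
  by apply/seteqP; split => x /=; rewrite mul1r.
have mblock := sigma_cylinders_measurable ind.1 (@block_sigma _ _ T xi k l a b K mK).
rewrite -(fineK (fin_num_measure (normal_prob 0 s) _ (mexit b))).
rewrite -(fineK (fin_num_measure (normal_prob 0 s) _ (mexit a))).
rewrite -(fineK (fin_num_measure P _ mblock)) -!EFinM -!EFinD !lee_fin; lra.
Qed.

(** The grid cutting each phase [q], of duration [d q], into [L] equal steps: step [j] lies in phase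
    [j %/ L]. *)
Definition grid_time (R : realType) (d : nat -> R) (L i : nat) : R :=
  \sum_(0 <= j < i) d (j %/ L)%N / L%:R.

Lemma grid_timeS (R : realType) (d : nat -> R) L i :
  grid_time d L i.+1 = grid_time d L i + d (i %/ L)%N / L%:R.
Proof. by rewrite /grid_time big_nat_recr. Qed.

Lemma grid_time_lt (R : realType) (d : nat -> R) L i j :
  (forall q, 0 < d q) -> (0 < L)%N -> (i < j)%N -> grid_time d L i < grid_time d L j.
Proof.
move=> d0 L0; elim: j => // j IH; rewrite ltnS leq_eqVlt => /predU1P[->|/IH ij].
  by rewrite grid_timeS ltrDl divr_gt0// ltr0n.
by apply: (lt_trans ij); rewrite grid_timeS ltrDl divr_gt0// ltr0n.
Qed.

Lemma grid_time_ge0 (R : realType) (d : nat -> R) L i :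
  (forall q, 0 < d q) -> 0 <= grid_time d L i.
Proof.
by move=> d0; rewrite /grid_time sumr_ge0// => j _; rewrite divr_ge0 ?ler0n// ltW.
Qed.

Lemma grid_timeE (R : realType) (d : nat -> R) L q j : (0 < L)%N -> (j <= L)%N ->
  grid_time d L (q * L + j) = \sum_(0 <= i < q) d i + d q * (j%:R / L%:R).
Proof.
move=> L0.
have step p k : (k <= L)%N ->
    grid_time d L (p * L + k) = grid_time d L (p * L) + d p * (k%:R / L%:R).
  elim: k => [|k IH] kL; first by rewrite addn0 mul0r mulr0 addr0.
  rewrite addnS grid_timeS IH ?(ltnW kL)// divnMDl// divn_small// addn0.
  by rewrite -addrA; congr (_ + _); rewrite -natr1 mulrDl mulrDr mul1r.
move=> jL; rewrite step//; congr (_ + _).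
elim: q => [|q IH]; first by rewrite mul0n /grid_time !big_geq.
rewrite mulSn addnC step// divff ?pnatr_eq0 -?lt0n// mulr1 IH.
by rewrite big_nat_recr.
Qed.

(* The M increments of the first coordinate come before those of the second
   one, so that events about different coordinates or different phases depend
   on disjoint blocks of a single independent sequence. *)
Definition grid_increments (R : realType) (T : Type) (Z : R -> T -> R * R)
    (t : nat -> R) (M i : nat) (w : T) : R :=
  if (i < M)%N then (Z (t i.+1) w - Z (t i) w).1
  else (Z (t (i - M).+1) w - Z (t (i - M)%N) w).2.

Lemma psum_grid_increments1 (R : realType) (T : Type) (Z : R -> T -> R * R)
    (t : nat -> R) (M i j : nat) (w : T) : (i <= j)%N -> (j <= M)%N ->
  psum (grid_increments Z t M) i j w = (Z (t j) w).1 - (Z (t i) w).1.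
Proof.
move=> ij jM; rewrite /psum (telescope_sumr_eq (fun i => (Z (t i) w).1))//.
by move=> k /andP[_ kj]; rewrite /grid_increments (leq_trans kj jM).
Qed.

Lemma psum_grid_increments2 (R : realType) (T : Type) (Z : R -> T -> R * R)
    (t : nat -> R) (M i j : nat) (w : T) : (M <= i)%N -> (i <= j)%N ->
  psum (grid_increments Z t M) i j w = (Z (t (j - M)%N) w).2 - (Z (t (i - M)%N) w).2.
Proof.
move=> Mi ij; rewrite /psum (telescope_sumr_eq (fun i => (Z (t (i - M)%N) w).2))//.
move=> k /andP[ik _]; rewrite /grid_increments ltnNge (leq_trans Mi ik)/=.
by rewrite subSn// (leq_trans Mi ik).
Qed.

Lemma independent_grid_increments (R : realType) d (T : measurableType d)
    (P : probability T R) z Z (t : nat -> R) M :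
  planar_brownian_motion P z Z -> (forall i, 0 <= t i) ->
  (forall i, t i < t i.+1) ->
  independent_upto P (grid_increments Z t M) (M + M).
Proof.
move=> bm t0 tS; have mZ i := pbm_measurable bm (t0 i).
split.
  move=> i; rewrite /grid_increments; case: ltnP => _; apply: measurable_funB.
  - exact: measurableT_comp measurable_fst (mZ _).
  - exact: measurableT_comp measurable_fst (mZ _).
  - exact: measurableT_comp measurable_snd (mZ _).
  - exact: measurableT_comp measurable_snd (mZ _).
move=> B mB.
pose N i := normal_prob 0 (Num.sqrt (t i.+1 - t i)).
(* Entries [i] and [M + i] are the two coordinates of one planar increment, so rectangles turn the
   planar product formula into the one for the flattened sequence. *)
pose A (i : 'I_M) := B i `*` B (M + i)%N.
have := pbm_increments_independent bm (n := M) (t0 0%N) (fun i _ => tS i).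
move=> /(_ A (fun i => measurableX (mB _) (mB _))).
rewrite (_ : \bigcap_i _ = \bigcap_(i in [set i | (i < M + M)%N])
    grid_increments Z t M i @^-1` B i); last first.
  apply/seteqP; split => w /= Aw.
    move=> i /= iM; rewrite /grid_increments /preimage/=; case: ltnP => Mi.
      by have [] := Aw (Ordinal Mi) I.
    have jM : (i - M < M)%N by lia.
    by have [_] := Aw (Ordinal jM) I; rewrite /= subnKC.
  move=> i _; have iM := ltn_ord i; split => /=.
    have /= := Aw i; rewrite /grid_increments/= iM; apply; lia.
  have /= := Aw (M + i)%N; rewrite /grid_increments/= ifF; last lia.
  by rewrite addKn; apply; lia.
move=> ->.
rewrite (eq_bigr (fun i : 'I_M => N i (B i) * N i (B (M + i)%N))%E); last first.
  by move=> i _; exact: pbm_increment_rect bm (t0 i) (tS i) (mB _) (mB _).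
rewrite big_split/= (big_cat_nat (n := M))//=; last exact: leq_addr.
congr (_ * _)%E.
  rewrite big_mkord; apply: eq_bigr => i _.
  rewrite /N -(pbm_law1 bm (t0 i) (tS i) (mB i)); congr (P _).
  by apply/seteqP; split => w/=; rewrite /grid_increments /preimage/= ltn_ord.
have -> F : (\prod_(M <= i < M + M) F i = \prod_(i < M) F (i + M)%N :> \bar R)%E.
  by rewrite -[X in index_iota X _]add0n big_addn addnK big_mkord.
apply: eq_bigr => i _.
rewrite /N addnC -(pbm_law2 bm (t0 i) (tS i) (mB _)); congr (P _).
by apply/seteqP; split => w/=; rewrite /grid_increments /preimage/= ltnNge leq_addl/= addnK.
Qed.

(** * From dyadic times to all times *)

Lemma dyadic_approx (R : realType) (s d u e : R) : 0 < d -> s <= u <= s + d ->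
  0 < e -> exists n j, [/\ (j <= 2 ^ n)%N,
    s + d * (j%:R / (2 ^ n)%:R) <= u & u - (s + d * (j%:R / (2 ^ n)%:R)) < e].
Proof.
move=> d0 /andP[su usd] e0.
(* The mesh [d / 2 ^ n] is made smaller than [e]; [j] then rounds [u] down to the grid. *)
have [n ne] : exists n, d / e < (2 ^ n)%:R.
  exists (Num.bound (d / e)); apply: (lt_trans (archi_boundP _)).
    by rewrite divr_ge0 ?ltW.
  by rewrite ltr_nat ltn_expl.
set L := (2 ^ n)%:R : R in ne *.
have L0 : 0 < L by rewrite ltr0n expn_gt0.
pose y := (u - s) / d * L.
have y0 : 0 <= y.
  by apply: mulr_ge0; [apply: divr_ge0; [rewrite subr_ge0|exact: ltW]|exact: ltW].
have /andP[jy yj] := truncn_itv y0.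
set j := Num.truncn y in jy yj.
have uE : u = s + d * (y / L) by rewrite /y; field; rewrite !gt_eqF.
exists n, j; rewrite -/L; split.
- rewrite -(ler_nat R) -/L (le_trans jy)// /y ler_piMl ?(ltW L0)//.
  by rewrite ler_pdivrMr// mul1r lerBlDl.
- by rewrite [leRHS]uE lerD2l ler_wpM2l ?(ltW d0)// ler_pM2r ?invr_gt0.
- have -> : u - (s + d * (j%:R / L)) = (y - j%:R) * (d / L).
    by rewrite {1}uE; field; rewrite gt_eqF.
  apply: (@le_lt_trans _ _ (d / L)).
    rewrite ler_piMl ?divr_ge0 ?(ltW L0) ?(ltW d0)//; move: yj; rewrite -natr1; lra.
  by rewrite ltr_pdivrMr// mulrC -ltr_pdivrMr.
Qed.

(** Dyadic times approach every [u] from the left, so by continuity [f u] lies in the closure of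
    [C]. *)
Lemma closed_dyadic (R : realType) (V : topologicalType) (f : R -> V)
    (C : set V) (s d : R) :
  {within `[0, +oo[, continuous f} -> 0 <= s -> 0 < d -> closed C ->
  (forall n j, (j <= 2 ^ n)%N -> C (f (s + d * (j%:R / (2 ^ n)%:R)))) ->
  forall u, s <= u <= s + d -> C (f u).
Proof.
move=> cf s0 d0 cC Cf u usd; apply: cC => B Bfu.
have u0 : `[0, +oo[%classic u by rewrite /= in_itv/= andbT; lra.
move/subspace_continuousP : cf => /(_ u u0 B Bfu).
rewrite /= /within/= /nbhs/= => -[e /= e0 He].
have [n [j [jn le_u lt_e]]] := dyadic_approx d0 usd e0.
exists (f (s + d * (j%:R / (2 ^ n)%:R))); split; first exact: Cf.
apply: He => /=.
  by rewrite ger0_norm ?subr_ge0.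
by rewrite in_itv/= andbT addr_ge0// mulr_ge0 ?divr_ge0 ?(ltW d0).
Qed.

Lemma closed_band (R : realType) (a b : \bar R) : closed (band a b).
Proof.
have cE : continuous (EFin : R -> \bar R) by move=> x; exact: cvg_id.
have cEN : continuous (fun x : R => (- x)%:E).
  by move=> x; apply: continuous_comp; [exact: continuousN|exact: cE].
rewrite (_ : band a b = (fun x : R => (- x)%:E) @^-1` [set y | (y <= a)%E] `&`
  (EFin : R -> \bar R) @^-1` [set y | (y <= b)%E])//.
apply: closedI.
  by move/continuous_closedP : cEN; apply; exact: closed_ereal_ge_ereal.
by move/continuous_closedP : cE; apply; exact: closed_ereal_ge_ereal.
Qed.

Lemma le_prod_EFin (R : realType) (n : nat) (c : nat -> R) (p : nat -> \bar R) :
  (forall q, 0 <= c q) -> (forall q, (q < n)%N -> ((c q)%:E <= p q)%E) ->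
  ((\prod_(0 <= q < n) c q)%:E <= \prod_(0 <= q < n) p q)%E.
Proof.
move=> c0; elim: n => [|n IH] cp; first by rewrite !big_geq.
rewrite !big_nat_recr//= EFinM lee_pmul ?lee_fin ?prodr_ge0//.
  by apply: IH => q qn; apply: cp; exact: ltnW.
exact: cp.
Qed.

(* Phase q < m has duration d q; entries q and m + q of a, b, K, c concern the
   first and the second coordinate during that phase. *)
Lemma pbm_phases (R : realType) dT (T : measurableType dT) (P : probability T R)
    z Z (d : nat -> R) (m : nat) (a b : nat -> \bar R) (K : nat -> set R)
    (c : nat -> R) (S := fun q => \sum_(0 <= i < q) d i) :
  planar_brownian_motion P z Z -> (forall q, 0 < d q) -> (forall q, 0 <= c q) ->
  (forall q, (q < m)%N -> phase (Num.sqrt (d q)) (a q) (b q) (K q) (c q)) ->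
  (forall q, (q < m)%N -> phase (Num.sqrt (d q))
    (a (m + q)%N) (b (m + q)%N) (K (m + q)%N) (c (m + q)%N)) ->
  exists G, [/\ measurable G, ((\prod_(0 <= q < m + m) c q)%:E <= P G)%E &
    forall w q, G w -> (q < m)%N ->
    [/\ forall u, S q <= u <= S q + d q ->
          band (a q) (b q) ((Z u w).1 - (Z (S q) w).1) /\
          band (a (m + q)%N) (b (m + q)%N) ((Z u w).2 - (Z (S q) w).2),
        K q ((Z (S q.+1) w).1 - (Z (S q) w).1) &
        K (m + q)%N ((Z (S q.+1) w).2 - (Z (S q) w).2)]].
Proof.
move=> bm d0 c0 ph1 ph2.
(* For an entry [q < m + m], [r q] is its phase and [pr q] its coordinate. *)
pose r q := if (q < m)%N then q else (q - m)%N.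
pose pr q (v : R * R) := if (q < m)%N then v.1 else v.2.
pose t n := grid_time d (2 ^ n).
pose xi n := grid_increments Z (t n) (m * 2 ^ n).
have L0 n : (0 < 2 ^ n)%N by rewrite expn_gt0.
pose E n q := block (xi n) (q * 2 ^ n) (q.+1 * 2 ^ n) (a q) (b q) (K q).
have S0 q : 0 <= S q by rewrite /S sumr_ge0// => i _; rewrite ltW.
have SS q : S q.+1 = S q + d q by rewrite /S big_nat_recr.
have t0 n i : 0 <= t n i by exact: grid_time_ge0.
have tlt n i j : (i < j)%N -> t n i < t n j by exact: grid_time_lt.
have psumE n q j w : (q < m + m)%N -> (j <= 2 ^ n)%N ->
    psum (xi n) (q * 2 ^ n) (q * 2 ^ n + j) w =
    pr q (Z (S (r q) + d (r q) * (j%:R / (2 ^ n)%:R)) w) - pr q (Z (S (r q)) w).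
  move=> qm jn; rewrite /pr /r; case: ltnP => mq.
    rewrite psum_grid_increments1 ?leq_addr//; last first.
      by rewrite (leq_trans (n := q.+1 * 2 ^ n))// ?leq_mul// mulSn addnC leq_add2r.
    rewrite /t grid_timeE// -{1}[(q * _)%N]addn0 grid_timeE//.
    by rewrite mul0r mulr0 addr0.
  rewrite psum_grid_increments2 ?leq_addr ?leq_mul//.
  rewrite -addnBAC ?leq_mul// -mulnBl /t grid_timeE// -{1}[((q - m) * _)%N]addn0 grid_timeE//.
  by rewrite mul0r mulr0 addr0.
have EE n q w : (q < m + m)%N -> E n q w <->
    (forall j, (j <= 2 ^ n)%N -> band (a q) (b q)
      (pr q (Z (S (r q) + d (r q) * (j%:R / (2 ^ n)%:R)) w) - pr q (Z (S (r q)) w)))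
    /\ K q (pr q (Z (S (r q).+1) w) - pr q (Z (S (r q)) w)).
  move=> qm; have Kend : psum (xi n) (q * 2 ^ n) (q.+1 * 2 ^ n) w =
      pr q (Z (S (r q).+1) w) - pr q (Z (S (r q)) w).
    have LL : (2 ^ n)%:R / (2 ^ n)%:R = 1 :> R by rewrite divff// pnatr_eq0 -lt0n.
    by rewrite mulSn addnC psumE// LL mulr1 SS.
  rewrite /E /block /mkset Kend; split => -[Eb ?]; split => // j jn.
    by rewrite -psumE//; apply: Eb; rewrite leq_addr mulSn addnC leq_add2r.
  case/andP: jn => qj jq; rewrite -(subnKC qj) psumE//; last first.
    by rewrite leq_subLR addnC -mulSn.
  by apply: Eb; rewrite leq_subLR addnC -mulSn.
have ind n : independent_upto P (xi n) (m * 2 ^ n + m * 2 ^ n).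
  by apply: independent_grid_increments bm _ _ => // i; exact: tlt.
have mK q : (q < m + m)%N -> measurable (K q).
  have [qm _|mq qmm] := ltnP q m; first by case: (ph1 q qm).
  have qm' : (q - m < m)%N by lia.
  by case: (ph2 _ qm') => +; rewrite subnKC.
have sE n q : (q < m + m)%N ->
    <<s cylinders (xi n) (q * 2 ^ n) (q.+1 * 2 ^ n) >> (E n q).
  by move=> qm; apply: block_sigma; exact: mK.
have PE n q : (q < m + m)%N -> ((c q)%:E <= P (E n q))%E.
  move=> qm; have [qlt|mq] := ltnP q m.
    apply: (phase_block (X := fun t w => (Z t w).1) (t := t n) (ind n)) => //.
    - by rewrite ltn_pmul2r.
    - by rewrite -mulnDl leq_mul.
    - by move=> i j /andP[_]; exact: tlt.
    - move=> i j w /andP[_ ij] jq; apply: psum_grid_increments1 => //.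
      by apply: leq_trans jq _; rewrite leq_mul.
    - exact: pbm_law1 bm.
    - have -> : t n (q.+1 * 2 ^ n)%N - t n (q * 2 ^ n)%N = d q.
        rewrite /t -[(q * _)%N]addn0 -[(q.+1 * _)%N]addn0 !grid_timeE// mul0r !mulr0 !addr0.
        by rewrite -!/(S _) SS addrC addKr.
      exact: ph1.
  have qm' : (q - m < m)%N by lia.
  apply: (phase_block (X := fun t w => (Z t w).2)
    (t := fun i => t n (i - m * 2 ^ n)%N) (ind n)) => //.
  - by rewrite ltn_pmul2r.
  - by rewrite -mulnDl leq_mul.
  - move=> i j /andP[qi ij]; apply: tlt.
    by have := leq_trans (leq_mul mq (leqnn (2 ^ n))) qi; lia.
  - move=> i j w /andP[qi ij] jq; apply: psum_grid_increments2 => //.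
    exact: leq_trans (leq_mul mq (leqnn (2 ^ n))) qi.
  - exact: pbm_law2 bm.
  - have -> : t n (q.+1 * 2 ^ n - m * 2 ^ n)%N - t n (q * 2 ^ n - m * 2 ^ n)%N = d (q - m)%N.
      rewrite -!mulnBl subSn//.
      rewrite /t -[((q - m) * _)%N]addn0 -[((q - m).+1 * _)%N]addn0.
      rewrite !grid_timeE// mul0r !mulr0 !addr0.
      by rewrite -!/(S _) SS addrC addKr.
    by have := ph2 _ qm'; rewrite subnKC.
pose G n := \bigcap_(q in [set q | (q < m + m)%N]) E n q.
have mG n : measurable (G n).
  apply: bigcap_measurableType => q /= qm.
  exact: (sigma_cylinders_measurable (ind n).1 (sE n q qm)).
have PG n : ((\prod_(0 <= q < m + m) c q)%:E <= P (G n))%E.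
  have mmN : ((m + m) * 2 ^ n <= m * 2 ^ n + m * 2 ^ n)%N by rewrite mulnDl.
  rewrite (independent_upto_blocks (ind n) mmN (fun q => sE n q)).2.
  by apply: le_prod_EFin => // q; exact: PE.
(* Point [j] of level [n] is point [2 j] of level [n.+1], so finer grids impose more constraints. *)
have Gdec : nonincreasing_seq G.
  apply/nonincreasing_seqP => n; apply/subsetPset => w Gw q /= qm.
  apply/EE => //; have /EE[//|Eb Ek] := Gw q qm; split=> // j jn.
  have j2 : (j * 2 <= 2 ^ n.+1)%N by rewrite expnSr leq_mul2r jn.
  have := Eb _ j2; rewrite expnSr !natrM -mulf_div divff ?pnatr_eq0//.
  by rewrite mulr1.
have mGoo : measurable (\bigcap_n G n) by exact: bigcapT_measurable.
(* The bound does not depend on [n], so continuity from above passes it to the intersection, where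
   the bands hold at all dyadic times of every phase. *)
exists (\bigcap_n G n); split => //.
  have cvg := nonincreasing_cvg_mu (mu := P) (F := G)
    (le_lt_trans (probability_le1 P (mG 0%N)) (ltry 1)) mG mGoo Gdec.
  rewrite -(cvg_lim _ cvg)//; apply: lime_ge; first by apply/cvg_ex; eexists; exact: cvg.
  by near=> n; exact: PG.
move=> w q Gw qm.
have Eq n : E n q w by apply: Gw => //=; lia.
have Eq' n : E n (m + q)%N w by apply: Gw => //=; lia.
have rq : r q = q by rewrite /r qm.
have rq' : r (m + q)%N = q by rewrite /r ifF ?addKn//; lia.
have prq v : pr q v = v.1 by rewrite /pr qm.
have prq' v : pr (m + q)%N v = v.2 by rewrite /pr ifF//; lia.
split; last 2 first.
- by have /EE[|_] := Eq 0%N; [lia|rewrite rq !prq].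
- by have /EE[|_] := Eq' 0%N; [lia|rewrite rq' !prq'].
have cont1 (x : R) : continuous (fun v : R * R => v.1 - x).
  by move=> v; apply: continuousB; [exact: cvg_fst|exact: cvg_cst].
have cont2 (x : R) : continuous (fun v : R * R => v.2 - x).
  by move=> v; apply: continuousB; [exact: cvg_snd|exact: cvg_cst].
move=> u Su; split.
  pose C := (fun v : R * R => v.1 - (Z (S q) w).1) @^-1` band (a q) (b q).
  suff : C (Z u w) by [].
  refine (@closed_dyadic R _ (Z ^~ w) C (S q) (d q)
    (@pbm_continuous _ _ _ _ _ _ bm w) (S0 q) (d0 q) _ _ u Su).
    by move/continuous_closedP : (cont1 (Z (S q) w).1); apply; exact: closed_band.
  move=> n j jn; have /EE[|+ _] := Eq n; first lia.
  by move=> /(_ j jn); rewrite rq !prq.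
pose C := (fun v : R * R => v.2 - (Z (S q) w).2) @^-1` band (a (m + q)%N) (b (m + q)%N).
suff : C (Z u w) by [].
refine (@closed_dyadic R _ (Z ^~ w) C (S q) (d q)
    (@pbm_continuous _ _ _ _ _ _ bm w) (S0 q) (d0 q) _ _ u Su).
  by move/continuous_closedP : (cont2 (Z (S q) w).2); apply; exact: closed_band.
move=> n j jn; have /EE[|+ _] := Eq' n; first lia.
by move=> /(_ j jn); rewrite rq' !prq'.
Unshelve. all: by end_near. Qed.

(** * Phases with explicit constants *)

Lemma phase_free (R : realType) (s c : R) (K : set R) : measurable K ->
  (c%:E <= normal_prob 0 s K)%E -> phase s +oo%E +oo%E K c.
Proof.
move=> mK cK; split=> //.
have -> : [set x : R | (+oo < x%:E)%E] = set0.
  by apply/seteqP; split => // x /=; rewrite ltNge leey.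
by rewrite measure0 mule0 !adde0.
Qed.

(** Each of the two barriers costs at most twice the tail bound [s / r]. *)
Lemma phase_stay (R : realType) (s r c : R) (K : set R) :
  0 < s -> 0 < r -> measurable K ->
  ((c + 4 * (s / r))%:E <= normal_prob 0 s K)%E -> phase s r%:E r%:E K c.
Proof.
move=> s0 r0 mK cK; split=> //; apply: le_trans cK.
have -> : [set x : R | (r%:E < x%:E)%E] = `]r, +oo[%classic.
  by apply/seteqP; split => x /=; rewrite in_itv/= andbT lte_fin.
have := normal_prob_gt s0 r0.
rewrite -(fineK (fin_num_measure (normal_prob 0 s) `]r, +oo[%classic _))//.
rewrite -!EFinM -!EFinD !lee_fin; lra.
Qed.

Lemma phase_stayT (R : realType) (s r : R) : 0 < s -> 8 * s <= r ->
  phase s r%:E r%:E setT 2^-1.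
Proof.
move=> s0 sr; have r0 : 0 < r by lra.
apply: phase_stay => //; rewrite probability_setT lee_fin.
have : s / r <= 8^-1 by rewrite ler_pdivrMr//; lra.
lra.
Qed.

(** The end condition has mass at least [4^-1] and the barriers cost at most [4 / 32], which leaves
    [8^-1]. *)
Lemma phase_stay_quarter (R : realType) (s r : R) : 0 < s -> 32 * s <= r ->
  phase s r%:E r%:E `[s / 4, +oo[%classic 8^-1.
Proof.
move=> s0 sr; have r0 : 0 < r by lra.
apply: phase_stay => //; apply: le_trans (normal_prob_quarter s0).
have : s / r <= 32^-1 by rewrite ler_pdivrMr//; lra.
by rewrite lee_fin; lra.
Qed.

(* The bound 1 - 2 P(X > 1/2) = P(|X| <= 1/2) for staying above -1/2 decays only
   like 1/s, which makes the exponent 1/2 critical. *)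
Lemma phase_halfline (R : realType) (s : R) : 1 <= s ->
  phase s (2^-1)%:E +oo%E setT (normal_pdf 0 1 2^-1 / s).
Proof.
move=> s1; have s0 : 0 < s by lra.
split => //; have -> : [set x : R | (+oo < x%:E)%E] = set0.
  by apply/seteqP; split => // x /=; rewrite ltNge leey.
rewrite measure0 mule0 adde0.
have -> : [set x : R | ((2^-1)%:E < x%:E)%E] = `]2^-1, +oo[%classic.
  by apply/seteqP; split => x /=; rewrite in_itv/= andbT lte_fin.
apply: le_trans (leeD (normal_prob_half s1) (lexx _)) _.
(* [A], [B] and the reflection of [B] are disjoint, so the mass of [A] plus twice that of [B] is at
   most the total mass. *)
pose A : set R := `[- 2^-1, 2^-1]%classic; pose B : set R := `]2^-1, +oo[%classic.
rewrite -/A -/B.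
have mA : measurable A by exact: measurable_itv.
have mB : measurable B by exact: measurable_itv.
set B' := [set x | B (- x)].
have mB' : measurable B'.
  rewrite (_ : B' = `]-oo, - 2^-1[%classic)//.
  by apply/seteqP; split => x; rewrite /B' /B/= !in_itv/= ?andbT ltrNr.
have B'B : normal_prob 0 s B' = normal_prob 0 s B by rewrite normal_prob_opp ?gt_eqF.
have dBB : B `&` B' = set0.
  apply/seteqP; split => // x [] /=; rewrite /B' /B/= !in_itv/= !andbT; lra.
have dA : A `&` (B `|` B') = set0.
  by apply/seteqP; split => // x []; rewrite /B' /B /A/= !in_itv/= !andbT => ? []; lra.
have : (normal_prob 0 s (A `|` (B `|` B')) <= normal_prob 0 s setT)%E.
  apply: le_measure; rewrite ?inE//.
  by apply: measurableU => //; exact: measurableU.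
have -> : normal_prob 0 s (A `|` (B `|` B')) =
    (normal_prob 0 s A + (normal_prob 0 s B + normal_prob 0 s B))%E.
  rewrite -{2}B'B measureU//; last exact: measurableU.
  by congr (_ + _)%E; rewrite measureU.
rewrite -(fineK (fin_num_measure (normal_prob 0 s) B _))//.
by rewrite -EFinM -EFinD mulr2n mulrDl !mul1r.
Qed.

(** * Expectation of a moment *)

(** The integral of a nonnegative function is a supremum over simple functions below it, hence
    monotone even for nonmeasurable functions. This spares a measurability proof for the exit time,
    an infimum over uncountably many times. *)
Lemma ge0_le_integral_nonmeasurable (R : realType) d (T : measurableType d)
    (mu : {measure set T -> \bar R}) (f g : T -> \bar R) :
  (forall w, (0 <= f w)%E) -> (forall w, (f w <= g w)%E) ->
  (\int[mu]_w f w <= \int[mu]_w g w)%E.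
Proof.
move=> f0 fg; have g0 w : (0 <= g w)%E by exact: le_trans (fg w).
rewrite !ge0_integralTE//; apply: le_ereal_sup => _ [h hf <-].
by exists h => // w; exact: le_trans (hf w) (fg w).
Qed.

(** The weights [2 ^+ k / 2] up to level [m] sum to at most [2 ^+ m], so the highest level
    containing [w] already pays for all of them; the sets need not be nested. *)
Lemma le_layers (R : realType) (T : Type) (G : nat -> set T) (F : T -> \bar R)
    (n : nat) (w : T) : (0 <= F w)%E ->
  (forall k, (k < n)%N -> G k w -> ((2 ^+ k)%:E <= F w)%E) ->
  ((\sum_(0 <= k < n) 2 ^+ k / 2 * \1_(G k) w)%:E <= F w)%E.
Proof.
move=> F0; elim: n => [|n IH] GF; first by rewrite big_geq.
have le2 m : \sum_(0 <= k < m) 2 ^+ k / 2 * \1_(G k) w <= 2 ^+ m / 2 :> R.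
  elim: m => [|m IHm]; first by rewrite big_geq// divr_ge0.
  rewrite big_nat_recr//= exprS.
  have : 2 ^+ m / 2 * \1_(G m) w <= 2 ^+ m / 2 :> R.
    by rewrite ler_piMr ?divr_ge0 ?exprn_ge0// indicE; case: (_ \in _).
  lra.
have [Gn|nGn] := pselect (G n w); last first.
  rewrite big_nat_recr//= indicE memNset// mulr0 addr0.
  by apply: IH => k kn; apply: GF; exact: ltnW.
apply: le_trans (GF n (leqnn _) Gn); rewrite lee_fin.
by apply: le_trans (le2 _) _; rewrite exprS mulrC mulKf.
Qed.

(** Every scale contributes the same amount [c / 2], which is the logarithmic divergence in finite
    form. *)
Lemma integral_layers (R : realType) d (T : measurableType d)
    (P : probability T R) (G : nat -> set T) (F : T -> \bar R) (n : nat) (c : R) :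
  (forall w, (0 <= F w)%E) -> (forall k, measurable (G k)) ->
  (forall k w, (k < n)%N -> G k w -> ((2 ^+ k)%:E <= F w)%E) ->
  (forall k, (k < n)%N -> ((c / 2 ^+ k)%:E <= P (G k))%E) ->
  ((n%:R * (c / 2))%:E <= \int[P]_w F w)%E.
Proof.
move=> F0 mG GF cP.
apply: (@le_trans _ _ (\int[P]_w (\sum_(0 <= k < n) 2 ^+ k / 2 * \1_(G k) w)%:E)%E);
  last first.
  apply: ge0_le_integral_nonmeasurable => w.
    rewrite lee_fin sumr_ge0// => k _; rewrite mulr_ge0 ?divr_ge0 ?exprn_ge0//.
  by apply: le_layers => // k kn Gk; exact: GF Gk.
under eq_integral do rewrite -sumEFin.
have mG1 k : measurable_fun setT ((fun w => (2 ^+ k / 2 * \1_(G k) w)%:E) : T -> \bar R).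
  by apply/measurable_EFinP; apply: measurable_funM.
have G1_ge0 k w : setT w -> (0 <= (2 ^+ k / 2 * \1_(G k) w)%:E :> \bar R)%E.
  by move=> _; rewrite lee_fin mulr_ge0 ?divr_ge0 ?exprn_ge0.
rewrite ge0_integral_sum//.
apply: (@le_trans _ _ (\sum_(0 <= k < n) (c / 2)%:E)%E).
  by rewrite sumEFin lee_fin big_const_nat subn0 iter_addr_0 mulr_natl.
rewrite !big_mkord; apply: lee_sum => k _.
under eq_integral do rewrite EFinM.
rewrite ge0_integralZl_EFin//; last by apply/measurable_EFinP.
rewrite integral_indic// setIT.
apply: le_trans (lee_wpmul2l _ (cP k (ltn_ord k))); last first.
  by rewrite lee_fin divr_ge0 ?exprn_ge0.
rewrite -EFinM lee_fin.
suff -> : 2 ^+ k / 2 * (c / 2 ^+ k) = c / 2 by [].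
by field; rewrite expf_neq0.
Qed.

(** Since [4 ^+ k >= 1], raising it to [p] gives at least its square root [2 ^+ k]. *)
Lemma poweR_pow4_ge (R : realType) (p : R) (k : nat) (t : \bar R) : 2^-1 <= p ->
  ((4 ^+ k)%:E <= t)%E -> ((2 ^+ k)%:E <= t `^ p)%E.
Proof.
move=> hp kt; have p0 : 0 <= p by rewrite (le_trans _ hp).
have k0 : (0 <= (4 ^+ k)%:E :> \bar R)%E by rewrite lee_fin exprn_ge0.
apply: (@le_trans _ _ ((4 ^+ k)%:E `^ p)%E); last first.
  by apply: gt0_ler_poweR => //; rewrite in_itv/= leey ?k0// (le_trans k0).
rewrite poweR_EFin lee_fin; apply: (@le_trans _ _ ((4 ^+ k) `^ 2^-1)).
  rewrite powR12_sqrt ?exprn_ge0//.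
  have -> : 4 ^+ k = (2 ^+ k) ^+ 2 :> R.
    by rewrite -exprM mulnC exprM; congr (_ ^+ k); rewrite expr2 -natrM.
  by rewrite sqrtr_sqr ger0_norm ?exprn_ge0.
by apply: ler_powR => //; rewrite exprn_ege1// ler1n.
Qed.

(** * Combs with integer abscissas *)

Definition integer_comb (R : realType) (b : int -> R) : set (R * R) :=
  comb_domain (fun n : int => n%:~R) b.

Lemma integer_combP (R : realType) (b : int -> R) (v : R * R) :
  integer_comb b v <-> forall m : int, v.1 = m%:~R -> `|v.2| < b m.
Proof.
split=> [Dv m vm|vb [m _ [/= vm]]].
  rewrite ltNge; apply/negP => bv; apply: Dv; exists m => //; split => //=.
  move: bv; rewrite ler_normr !in_itv/= andbT => /orP[|bv]; [by left|right].
  by rewrite lerNr.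
rewrite !in_itv/= andbT lerNr => bv; have := vb m vm.
by rewrite ltNge ler_normr => /negP; apply; apply/orP.
Qed.

Lemma intr_between (R : realType) (n m : int) (x : R) :
  n%:~R < x < (n + 1)%:~R -> x <> m%:~R.
Proof. by move=> + xm; rewrite xm !ltr_int; lia. Qed.

Lemma integer_comb_strip (R : realType) (b : int -> R) (n : int) (v : R * R) :
  n%:~R < v.1 < (n + 1)%:~R -> integer_comb b v.
Proof. by move=> nv; apply/integer_combP => m /(intr_between nv). Qed.

Lemma comb_data_int (R : realType) (b : int -> R) : (forall n, 0 < b n) ->
  comb_data (fun n : int => n%:~R) b.
Proof.
move=> b0; split => //; first by move=> m n; rewrite ltr_int.
apply/seteqP; split => // t lt.
(* Near any [t] the only possible integer is [t] itself: [e] is 1 if [t] is an integer, and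
   otherwise the distance to the nearer neighbour. *)
have [e e0 He] : exists2 e : R, 0 < e &
    forall m : int, `|t - m%:~R| < e -> t = m%:~R.
  have /andP[nt tn] := floor_itv t; set n := Num.floor t in nt tn.
  rewrite le_eqVlt in nt; case/predU1P: nt => [nt|nt].
    exists 1 => // m; rewrite -nt -intrB -intr_norm -[1]/(1%:~R) ltr_int => nm.
    by congr (_%:~R); lia.
  exists (Num.min (t - n%:~R) ((n + 1)%:~R - t)).
    by rewrite lt_min !subr_gt0 nt tn.
  move=> m; rewrite lt_min !ltr_norml => /andP[/andP[h1 h2] /andP[h3 h4]].
  have nm : n%:~R < (m%:~R : R) < (n + 1)%:~R by apply/andP; split; lra.
  by case: (intr_between nm (erefl (m%:~R : R))).
have := lt [set y | `|t - y| < e]; case.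
  by apply/nbhs_ballP; exists e.
by move=> y [/eqP yt [m _ my]]; rewrite -my => /He tm; apply: yt; rewrite -my -tm.
Qed.

(** The starting point may lie in the gap of a slit, so the box can straddle that line. The room
    [2 * r] on the right allows the path to be moved inside the strip after it. *)
Lemma integer_comb_box (R : realType) (b : int -> R) (z : R * R) :
  integer_comb b z -> exists r, [/\ 0 < r, r <= 2^-1,
    z.1 + 2 * r <= (Num.floor z.1 + 1)%:~R &
    forall v : R * R, `|v.1 - z.1| <= r -> `|v.2 - z.2| <= r -> integer_comb b v].
Proof.
move=> /integer_combP zb; have /andP[nz zn] := floor_itv z.1.
set n := Num.floor z.1 in nz zn *.
rewrite le_eqVlt in nz; case/predU1P: nz => [nz|nz].
  have bz := zb n (esym nz).
  exists (Num.min 4^-1 ((b n - `|z.2|) / 2)); split.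
  - by rewrite lt_min; apply/andP; split; lra.
  - by rewrite ge_min; apply/orP; left; lra.
  - have : Num.min 4^-1 ((b n - `|z.2|) / 2) <= 4^-1 by rewrite ge_min lexx.
    rewrite -nz intrD; lra.
  - move=> v; rewrite !le_min => /andP[v1 _] /andP[_ v2].
    apply/integer_combP => m vm.
    have -> : m = n.
      move: v1; rewrite vm -nz -intrB -intr_norm => mn.
      have : `|m - n|%:~R < (1%:~R : R) by apply: (le_lt_trans mn); lra.
      by rewrite ltr_int; lia.
    have := ler_normD (v.2 - z.2) z.2; rewrite subrK; lra.
exists (Num.min 4^-1 (Num.min ((z.1 - n%:~R) / 2) (((n + 1)%:~R - z.1) / 2))).
set r := Num.min _ _.
have r1 : r <= 4^-1 by rewrite ge_min lexx.
have r2 : r <= (z.1 - n%:~R) / 2 by rewrite !ge_min lexx orbT.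
have r3 : r <= ((n + 1)%:~R - z.1) / 2 by rewrite !ge_min lexx !orbT.
split.
- by rewrite !lt_min; apply/and3P; split; lra.
- lra.
- lra.
- move=> v; rewrite ler_norml => /andP[v1 v1'] _.
  by apply: (integer_comb_strip (n := n)); apply/andP; split; lra.
Qed.

(* Bounds from below the probability to jump beyond N + 1 in time 1/64 from any
   strip (n, n + 1) with |n| <= N. *)
Definition far_tail (R : realType) (N : nat) : R :=
  fine (normal_prob 0 8^-1 `[(2 * N + 1)%:R, +oo[).

Definition num_scales (R : realType) (N : nat) : nat :=
  Num.bound (N%:R / far_tail R N).

(* A displacement of 8 * 2^K is at least eight standard deviations at the times
   4^k, k < K. *)
Definition slit_height (R : realType) (n : int) : R :=
  3 + \sum_(0 <= k < `|n|%N) 8 * 2 ^+ num_scales R k.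

Lemma far_tailE (R : realType) (N : nat) :
  (far_tail R N)%:E = normal_prob 0 8^-1 `[(2 * N + 1)%:R, +oo[%classic.
Proof. by rewrite fineK// fin_num_measure. Qed.

Lemma far_tail_gt0 (R : realType) (N : nat) : 0 < far_tail R N.
Proof.
rewrite -lte_fin far_tailE; apply: normal_prob_ray_gt0.
by rewrite invr_gt0.
Qed.

Lemma num_scales_gt (R : realType) (N : nat) :
  N%:R < (num_scales R N)%:R * far_tail R N.
Proof.
have q0 := far_tail_gt0 R N.
by rewrite -ltr_pdivrMr// archi_boundP// divr_ge0// ltW.
Qed.

(** Every gap contains [|y| <= 2], so a horizontal jump at such heights hits no slit, wherever it
    passes. *)
Lemma slit_height_gt2 (R : realType) (n : int) : 2 < slit_height R n.
Proof.
have : 0 <= \sum_(0 <= k < `|n|%N) 8 * 2 ^+ num_scales R k :> R.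
  by rewrite sumr_ge0// => k _; rewrite mulr_ge0 ?exprn_ge0.
rewrite /slit_height; lra.
Qed.

Lemma slit_height_gt (R : realType) (N : nat) (n : int) : (N < `|n|)%N ->
  2 + 8 * 2 ^+ num_scales R N < slit_height R n.
Proof.
move=> Nn; rewrite /slit_height (big_cat_nat (n := N.+1))//= big_nat_recr//=.
have : 0 <= \sum_(0 <= k < N) 8 * 2 ^+ num_scales R k :> R.
  by rewrite sumr_ge0// => k _; rewrite mulr_ge0 ?exprn_ge0.
have : 0 <= \sum_(N.+1 <= k < `|n|%N) 8 * 2 ^+ num_scales R k :> R.
  by rewrite sumr_ge0// => k _; rewrite mulr_ge0 ?exprn_ge0.
by move: (2 ^+ num_scales R N) (\sum_(0 <= k < N) _) (\sum_(N.+1 <= k < _) _) => *; lra.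
Qed.

(** * Survival in the comb *)

Lemma exit_time_ge (R : realType) (T : Type) (D : set (R * R))
    (Z : R -> T -> R * R) (w : T) (t : R) :
  (forall u, 0 <= u <= t -> D (Z u w)) -> (t%:E <= exit_time D Z w)%E.
Proof.
move=> DZ; apply: le_ereal_inf_tmp => _ [u [u0 nDu] <-].
rewrite lee_fin leNgt; apply/negP => ut; apply: nDu; apply: DZ.
by rewrite u0 ltW.
Qed.

Lemma intr_crossing_le (R : realType) (N : nat) (n : int) : (`|n| <= N)%N ->
  (N%:Z + 1 - n)%:~R <= (2 * N + 1)%:R :> R.
Proof.
move=> nN; have -> : (2 * N + 1)%:R = ((2 * N + 1)%N%:Z)%:~R :> R by rewrite -pmulrn.
by rewrite ler_int; lia.
Qed.

Lemma intr_lt_absz (R : realType) (N : nat) (m : int) :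
  N%:Z%:~R < (m%:~R : R) -> (N < `|m|)%N.
Proof. by rewrite ltr_int; lia. Qed.

Lemma band_norm (R : realType) (r x : R) : band r%:E r%:E x -> `|x| <= r.
Proof. by rewrite /band/= !lee_fin ler_norml => -[xr rx]; rewrite rx lerNl xr. Qed.

(* Four phases: a box around z, until the path is inside a strip; the strip,
   until |y| <= 1; a jump to the right beyond N + 1 with |y| <= 2; and the
   half-plane {x > N} for a time 4^k. *)
Lemma comb_survival (R : realType) dT (T : measurableType dT)
    (P : probability T R) (z : R * R) (Z : R -> T -> R * R)
    (D := integer_comb (@slit_height R)) :
  D z -> planar_brownian_motion P z Z ->
  exists2 C : R, 0 < C & forall N k : nat, (`|Num.floor z.1| <= N)%N ->
    (k < num_scales R N)%N -> exists G, [/\ measurable G,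
    ((C * far_tail R N / 2 ^+ k)%:E <= P G)%E &
    forall w, G w -> ((4 ^+ k)%:E <= exit_time D Z w)%E].
Proof.
move=> Dz bm; have [r [r0 r12 rfloor box]] := integer_comb_box Dz.
have /andP[nz zn] := floor_itv z.1; set n := Num.floor z.1 in nz zn rfloor *.
(* A quarter of the standard deviation [r / 32] of the first phase: the path ends at least [h] to
   the right while staying in the box. In the second phase [h / 2] is eight standard deviations
   [h / 16]. *)
pose h := r / 128.
have h0 : 0 < h by rewrite divr_gt0.
(* The chance of bringing [y] down to the centre in the short second phase; it depends on [z] but
   not on [N] or [k]. *)
pose qy := fine (normal_prob 0 (h / 16) `[- 2^-1 - z.2, 2^-1 - z.2]).
have qyE : qy%:E = normal_prob 0 (h / 16) `[- 2^-1 - z.2, 2^-1 - z.2]%classic.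
  by rewrite fineK// fin_num_measure.
have h16 : 0 < h / 16 by rewrite divr_gt0.
have qy0 : 0 < qy.
  by rewrite -lte_fin qyE normal_prob_itv_gt0//; lra.
pose pk : R := normal_pdf 0 1 2^-1.
have pk0 : 0 < pk by exact: normal_pdf_gt0.
(* The product of the eight constants [c q] below, without [far_tail R N] and [2 ^+ k]. *)
exists (8^-1 * 2^-1 * pk * 2^-1 * qy * 2^-1 * 2^-1).
  by rewrite !mulr_gt0.
move=> N k nN kN.
pose M : R := 8 * 2 ^+ num_scales R N.
(* Durations are squares of standard deviations, with default 1 to stay positive. In the next lists,
   entries 0 to 3 concern [x] and entries 4 to 7 concern [y]. *)
pose d q : R := nth 1 [:: (r / 32) ^+ 2; (h / 16) ^+ 2; (8^-1) ^+ 2; (2 ^+ k) ^+ 2] q.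
pose a q := nth +oo%E [:: r%:E; (h / 2)%:E; +oo%E; (2^-1)%:E; r%:E; +oo%E; 1%:E; M%:E] q.
pose b q := nth +oo%E [:: r%:E; (h / 2)%:E; +oo%E; +oo%E; r%:E; +oo%E; 1%:E; M%:E] q.
pose K q : set R := nth setT [:: `[h, +oo[%classic; setT;
  `[(N%:Z + 1 - n)%:~R, +oo[%classic; setT; setT;
  `[- 2^-1 - z.2, 2^-1 - z.2]%classic; setT; setT] q.
pose c q : R := nth 0 [:: 8^-1; 2^-1; far_tail R N; pk / 2 ^+ k; 2^-1; qy; 2^-1; 2^-1] q.
have k1 : 1 <= 2 ^+ k :> R by rewrite exprn_ege1// ler1n.
have d0 q : 0 < d q.
  rewrite /d; move: q => [|[|[|[|q]]]] /=; rewrite ?exprn_gt0 ?divr_gt0//.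
  by rewrite nth_nil.
have q0 := far_tail_gt0 R N.
have c0 q : 0 <= c q.
  rewrite /c; move: q => [|[|[|[|[|[|[|[|q]]]]]]]] /=;
    rewrite ?nth_nil ?invr_ge0 ?divr_ge0 ?(ltW qy0) ?(ltW q0) ?(ltW pk0) ?exprn_ge0//.
have sq x : 0 < x -> Num.sqrt (x ^+ 2) = x :> R.
  by move=> x0; rewrite sqrtr_sqr gtr0_norm.
have r32 : 0 < r / 32 by rewrite divr_gt0.
have e8 : 0 < 8^-1 :> R by rewrite invr_gt0.
have k0 : 0 < 2 ^+ k :> R by exact: lt_le_trans k1.
have ph1 q : (q < 4)%N -> phase (Num.sqrt (d q)) (a q) (b q) (K q) (c q).
  move: q => [|[|[|[|//]]]] _; rewrite /d /a /b /K /c/= sq//.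
  - have -> : h = r / 32 / 4 by rewrite /h; lra.
    by apply: phase_stay_quarter => //; lra.
  - by apply: phase_stayT => //; lra.
  - apply: phase_free => //; rewrite far_tailE.
    apply: le_measure; rewrite ?inE//; apply: subset_itvr; rewrite bnd_simp.
    exact: intr_crossing_le.
  - exact: phase_halfline.
have ph2 q : (q < 4)%N -> phase (Num.sqrt (d q))
    (a (4 + q)%N) (b (4 + q)%N) (K (4 + q)%N) (c (4 + q)%N).
  move: q => [|[|[|[|//]]]] _; rewrite /d /a /b /K /c/= sq//.
  - by apply: phase_stayT => //; lra.
  - by apply: phase_free => //; rewrite qyE.
  - by apply: phase_stayT => //; lra.
  - apply: phase_stayT => //; rewrite /M ler_pM2l// ler_weXn2l ?ler1n//.
    exact: ltnW.
have [G [mG PG HG]] := pbm_phases bm d0 c0 ph1 ph2.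
exists G; split => //.
  apply: le_trans PG; rewrite lee_fin /c -[(4 + 4)%N]/8%N 8?big_nat_recr//= big_geq// mul1r.
  rewrite le_eqVlt; apply/orP; left; apply/eqP; ring.
move=> w Gw.
pose S q := \sum_(0 <= i < q) d i.
have S0 : S 0%N = 0 by rewrite /S big_geq.
have SS q : S q.+1 = S q + d q by rewrite /S big_nat_recr.
have d30 : 4 ^+ k <= S 4.
  have -> : 4 ^+ k = d 3 :> R.
    by rewrite /d/= -exprM mulnC exprM; congr (_ ^+ k); rewrite expr2 -natrM.
  have := d0 0%N; have := d0 1%N; have := d0 2; rewrite !SS S0; lra.
have {}HG q : (q < 4)%N -> [/\ forall u, S q <= u <= S q.+1 ->
      band (a q) (b q) ((Z u w).1 - (Z (S q) w).1) /\
      band (a (4 + q)%N) (b (4 + q)%N) ((Z u w).2 - (Z (S q) w).2),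
    K q ((Z (S q.+1) w).1 - (Z (S q) w).1) &
    K (4 + q)%N ((Z (S q.+1) w).2 - (Z (S q) w).2)].
  by move=> q4; rewrite SS; have := HG w q Gw q4; rewrite -/(S q) -/(S q.+1) SS; apply.
have [b0 e0 _] := HG 0%N isT.
have [b1 _ f1] := HG 1%N isT.
have [b2 e2 _] := HG 2 isT.
have [b3 _ _] := HG 3 isT.
have d0' q : S q <= S q.+1 by rewrite SS lerDl ltW.
rewrite S0 (pbm_start bm w) in b0 e0.
have {b0}box0 u : 0 <= u <= S 1%N ->
    `|(Z u w).1 - z.1| <= r /\ `|(Z u w).2 - z.2| <= r.
  by move=> /b0[bx by_]; split; [exact: band_norm bx|exact: band_norm by_].
have {b1}box1 u : S 1%N <= u <= S 2 -> `|(Z u w).1 - (Z (S 1%N) w).1| <= h / 2.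
  by move=> /b1[bx _]; exact: band_norm bx.
have {b2}box2 u : S 2 <= u <= S 3 -> `|(Z u w).2 - (Z (S 2) w).2| <= 1.
  by move=> /b2[_ by_]; exact: band_norm by_.
have {b3}box3 u : S 3 <= u <= S 4 -> (Z (S 3) w).1 - 2^-1 <= (Z u w).1 /\
    `|(Z u w).2 - (Z (S 3) w).2| <= M.
  move=> /b3[[bx _] by_]; split; last exact: band_norm by_.
  by move: bx; rewrite /a/= lee_fin; lra.
have {e0}end0 : h <= (Z (S 1%N) w).1 - z.1.
  by move: e0; rewrite /K/= in_itv/= andbT.
have {f1}end1 : - 2^-1 - z.2 <= (Z (S 2) w).2 - (Z (S 1%N) w).2 <= 2^-1 - z.2.
  by move: f1; rewrite /K/= in_itv/=.
have {e2}end2 : (N%:Z + 1 - n)%:~R <= (Z (S 3) w).1 - (Z (S 2) w).1.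
  by move: e2; rewrite /K/= in_itv/= andbT.
have S1_ge0 : 0 <= S 1%N by rewrite -S0.
have hr : h = r / 128 by [].
(* The abscissa starts between [z.1 + h] and [z.1 + r] and then moves by at most [h / 2]. *)
have strip1 u : S 1%N <= u <= S 2 -> n%:~R < (Z u w).1 < (n + 1)%:~R.
  move=> /box1; have [] := box0 (S 1%N); first by rewrite S1_ge0 lexx.
  rewrite !ler_norml => /andP[x1 x2] _ /andP[x3 x4].
  by apply/andP; split; lra.
(* The first phase displaces [y] by at most [r <= 2^-1], and the second moves it by [- z.2] up to
   another [2^-1]. *)
have central2 : `|(Z (S 2) w).2| <= 1.
  have [] := box0 (S 1%N); first by rewrite S1_ge0 lexx.
  move=> _; rewrite !ler_norml => /andP[y1 y2].
  by case/andP: end1 => y3 y4; apply/andP; split; lra.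
have central3 u : S 2 <= u <= S 3 -> `|(Z u w).2| <= 2.
  move=> /box2; move: central2; rewrite !ler_norml => /andP[y1 y2] /andP[y3 y4].
  by apply/andP; split; lra.
apply: le_trans (exit_time_ge (t := S 4) _); first by rewrite lee_fin.
move=> u /andP[u0 u4].
have [u1|u1] := leP u (S 1%N).
  by apply: box; have [] := box0 u; rewrite ?u0.
have [u2|u2] := leP u (S 2).
  by apply: integer_comb_strip (strip1 u _); rewrite ltW.
have [u3|u3] := leP u (S 3).
  apply/integer_combP => m _; apply: le_lt_trans (slit_height_gt2 R m).
  by apply: central3; rewrite ltW.
apply/integer_combP => m um.
have [xu yu] : (Z (S 3) w).1 - 2^-1 <= (Z u w).1 /\
    `|(Z u w).2 - (Z (S 3) w).2| <= M by apply: box3; rewrite ltW.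
(* The jump of at least [N + 1 - n] starts to the right of [n]; losing at most [2^-1] afterwards,
   the path stays to the right of [N] and can only meet slits beyond it. *)
have Nm : (N < `|m|)%N.
  have : N%:Z%:~R < (m%:~R : R).
    have := strip1 (S 2); rewrite lexx d0' => /(_ isT)/andP[x1 _].
    by move: end2; rewrite -um intrD rmorphN/= intrD /=; lra.
  exact: intr_lt_absz.
apply: le_lt_trans (slit_height_gt R Nm); rewrite -/M.
have := central3 (S 3); rewrite lexx d0' => /(_ isT) y3.
have := ler_normD ((Z u w).2 - (Z (S 3) w).2) (Z (S 3) w).2.
by rewrite subrK; lra.
Qed.

(** * Divergence of the moments *)

Theorem proposition3 (R : realType) (p : R) (hp : 2^-1 <= p) :
  exists x b : int -> R,
    comb_data x b /\ infinite_exit_moment (comb_domain x b) p.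
Proof.
exists (fun n : int => n%:~R), (@slit_height R); split.
  by apply: comb_data_int => n; have := slit_height_gt2 R n; lra.
move=> d T P z Z Dz bm; have [C C0 HC] := comb_survival Dz bm.
apply/eqyP => A A0.
(* [N] must exceed the index of the starting strip and satisfy [A <= N * (C / 2)]; the choice of
   [num_scales] then makes the sum over scales at least [A]. *)
pose N := maxn `|Num.floor z.1| (Num.bound (A / (C / 2))).
have NA : A <= N%:R * (C / 2).
  rewrite -ler_pdivrMr ?divr_gt0//.
  apply: (le_trans (ltW (archi_boundP _))); first by rewrite !divr_ge0// ltW.
  by rewrite ler_nat leq_maxr.
have Nz : (`|Num.floor z.1| <= N)%N by exact: leq_maxl.
have [G HG] : exists G : nat -> set T, forall k, (k < num_scales R N)%N ->
    [/\ measurable (G k), ((C * far_tail R N / 2 ^+ k)%:E <= P (G k))%E &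
    forall w, G k w -> ((4 ^+ k)%:E <=
      exit_time (integer_comb (@slit_height R)) Z w)%E].
  have /choice[G HG] k : exists G : set T, (k < num_scales R N)%N ->
    [/\ measurable G, ((C * far_tail R N / 2 ^+ k)%:E <= P G)%E &
    forall w, G w -> ((4 ^+ k)%:E <=
      exit_time (integer_comb (@slit_height R)) Z w)%E].
    have [kN|_] := boolP (k < num_scales R N)%N; last by exists setT.
    by have [G HG] := HC N k Nz kN; exists G.
  by exists G.
(* Scales outside the range get [set0], since [integral_layers] takes a sequence of events all of
   which are measurable. *)
pose G' k := if (k < num_scales R N)%N then G k else set0.
have := @integral_layers R d T P G' (fun w => (exit_time
  (integer_comb (@slit_height R)) Z w `^ p)%E) (num_scales R N) (C * far_tail R N).
move=> /(_ (fun w => poweR_ge0 _ _)) h.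
apply: le_trans (h _ _ _).
- rewrite lee_fin (le_trans NA)//.
  have -> : (num_scales R N)%:R * (C * far_tail R N / 2) =
      (num_scales R N)%:R * far_tail R N * (C / 2) by ring.
  by rewrite ler_pM2r ?divr_gt0// ltW// num_scales_gt.
- by move=> k; rewrite /G'; case: ifPn => // /HG[].
- move=> k w kN; rewrite /G' kN => Gw; apply: poweR_pow4_ge => //.
  by have [_ _] := HG k kN; exact.
- by move=> k kN; rewrite /G' kN; have [] := HG k kN.
Qed.
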